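(* Let $\mathfrak g=sl_{r+1}$, let $V_{r+1}$ be its vector representation and $\omega_1$ its first fundamental weight, and let $d\ge1$, $n\ge0$ be integers. Let $\mathbb C[\mathbf x_1,\dots,\mathbf x_n]$ be the algebra of polynomials in $n$ multivariables $\mathbf x_i=(x_i^1,\dots,x_i^d)\in\mathbb C^d$, with $\Sigma_n$ permuting the multivariables, and let $\mathbb C[\mathbf x_1,\dots,\mathbf x_n]_+^{\Sigma_n}$ be the space of $\Sigma_n$-invariant polynomials vanishing at the origin. Put $$\mathcal D=\mathbb C[\mathbf x_1,\dots,\mathbf x_n]\Big/\Big(\mathbb C[\mathbf x_1,\dots,\mathbf x_n]_+^{\Sigma_n}\cdot\mathbb C[\mathbf x_1,\dots,\mathbf x_n]\Big).$$ Then there is an isomorphism of $sl_{r+1}$-modules $$W_{\mathbb C^d}(\{0\}_{n\omega_1})\cong\left(V_{r+1}^{\otimes n}\otimes\mathcal D\right)^{\Sigma_n},$$ where $W_{\mathbb C^d}(\{0\}_{n\omega_1})$ is the local Weyl module at the origin.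
   Context: All vector spaces and algebras are over $\mathbb C$. On the right hand side, $sl_{r+1}$ acts on the factors $V_{r+1}$, and $\Sigma_n$ acts diagonally: on $V_{r+1}^{\otimes n}$ by permuting the factors, and on $\mathcal D$ by the action induced from permuting multivariables. Let $A=\mathbb C[x^1,\dots,x^d]$ be the algebra of functions on $\mathbb C^d$, and let $\mathfrak g\otimes A$ have the bracket $[x\otimes P,y\otimes Q]=[x,y]\otimes PQ$. Let $\mathfrak h$ be the Cartan subalgebra of $\mathfrak g$, $\mathfrak n_+$ the positive nilpotent subalgebra, $h_1,\dots,h_r$ the simple coroots. A $\mathfrak g$-module $V$ is integrable if $V=\bigoplus_{\mu\in D}V^\mu$ for a finite subset $D$ of the weight lattice, where each $h\in\mathfrak h$ acts on $V^\mu$ by $\mu(h)$. The local Weyl module $W_{\mathbb C^d}(\{0\}_{n\omega_1})$ is the maximal $\mathfrak g\otimes A$-module that is integrable over $\mathfrak g\otimes1\cong\mathfrak g$ and generated by a vector $v$ with, for all $P\in A$, $(\mathfrak n_+\otimes P)v=0$, $(h_1\otimes P)v=nP(0)v$, $(h_i\otimes P)v=0$ for $i>1$. ''Maximal'' means that any other such module is a quotient of it (generator mapping to generator). It is an $sl_{r+1}$-module via $\mathfrak g\otimes1$. *)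

(* Defs.v *)
From HB Require Import structures.
From mathcomp Require Import all_boot all_order all_algebra all_fingroup.
From mathcomp Require Import generic_quotient ring_quotient.
From mathcomp Require Import boolp reals.
From mathcomp Require Import mpoly.
From mathcomp.real_closed Require Import complex.

Set Implicit Arguments.
Unset Strict Implicit.
Unset Printing Implicit Defensive.

Import GRing.Theory.
Local Open Scope ring_scope.
Local Open Scope quotient_scope.

Definition traceless (K : fieldType) (r : nat) : {pred 'M[K]_r.+1} :=
  fun x => \tr x == 0.

Fact traceless_submod_closed (K : fieldType) (r : nat) :
  submod_closed (@traceless K r).
Proof.
split=> [|a x y]; rewrite !unfold_in ?linear0 // => /eqP hx /eqP hy.
by rewrite linearP /= hx hy mulr0 addr0.
Qed.

HB.instance Definition _ (K : fieldType) (r : nat) :=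
  GRing.isSubmodClosed.Build K 'M[K]_r.+1 (@traceless K r)
    (@traceless_submod_closed K r).

Record sl (K : fieldType) (r : nat) : Type :=
  Sl { sl_mx :> 'M[K]_r.+1; _ : sl_mx \in @traceless K r }.

HB.instance Definition _ (K : fieldType) (r : nat) := [isSub for @sl_mx K r].
HB.instance Definition _ (K : fieldType) (r : nat) := [Choice of sl K r by <:].
HB.instance Definition _ (K : fieldType) (r : nat) :=
  [SubChoice_isSubLmodule of sl K r by <:].

Fact sl_bracket_subproof (K : fieldType) (r : nat) (x y : sl K r) :
  x *m y - y *m x \in @traceless K r.
Proof. by rewrite unfold_in linearB /= mxtrace_mulC subrr. Qed.

Definition sl_bracket (K : fieldType) (r : nat) (x y : sl K r) : sl K r :=
  Sl (sl_bracket_subproof x y).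

Definition in_cartan (K : fieldType) (r : nat) (h : sl K r) : Prop :=
  is_diag_mx h.

Definition in_nilp (K : fieldType) (r : nat) (x : sl K r) : Prop :=
  forall i j : 'I_r.+1, (j <= i)%N -> x i j = 0.

Fact coroot_subproof (K : fieldType) (r : nat) (i : 'I_r) :
  (delta_mx (lift ord_max i) (lift ord_max i)
   - delta_mx (lift ord0 i) (lift ord0 i) : 'M[K]_r.+1) \in @traceless K r.
Proof.
have E (k : 'I_r.+1) : \tr (delta_mx k k : 'M[K]_r.+1) = 1.
  rewrite /mxtrace (bigD1 k) //= mxE !eqxx big1 ?addr0 // => j /negPf jk.
  by rewrite mxE jk.
by rewrite unfold_in linearB /= !E subrr.
Qed.

(* lift ord_max i and lift ord0 i are the positions i and i + 1, so this is
   E_{i,i} - E_{i+1,i+1}; simple coroots are numbered from 0. *)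
Definition coroot (K : fieldType) (r : nat) (i : 'I_r) : sl K r :=
  Sl (coroot_subproof K i).

(* The value at h of the i-th fundamental weight. *)
Definition fund_weight (K : fieldType) (r : nat) (i : 'I_r) (h : sl K r) : K :=
  \sum_(j < r.+1 | (j <= i)%N) h j j.

Lemma fund_weight_coroot (K : fieldType) (r : nat) (i j : 'I_r) :
  fund_weight i (coroot K j) = (i == j)%:R.
Proof.
rewrite /fund_weight /=.
under eq_bigr do rewrite !mxE !andbb.
rewrite sumrB.
have E (k : 'I_r.+1) :
  \sum_(l < r.+1 | (l <= i)%N) (l == k)%:R = (k <= i)%:R :> K.
  have [ki|ki] := leqP k i.
    rewrite (bigD1 k) //= eqxx big1 ?addr0 // => l /andP[_ /negPf->] //.
  rewrite big1 // => l li; case: eqP => // lk; by rewrite -lk ltnNge li in ki.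
rewrite !E lift_max lift0; case: (ltngtP i j) => [ij|ij|/val_inj->].
- by rewrite subrr -val_eqE /= ltn_eqF.
- by rewrite subrr -val_eqE /= gtn_eqF.
- by rewrite subr0 eqxx.
Qed.

(* A weight is given by its integer coordinates m in the basis of fundamental
   weights, that is m_i = mu(h_i); this is its value mu(h). *)
Definition weight_val (K : fieldType) (r : nat) (m : 'rV[int]_r) (h : sl K r)
    : K :=
  \sum_(i < r) (m 0 i)%:~R * fund_weight i h.

Record sl_action (K : fieldType) (r : nat) (V : lmodType K)
    (act : sl K r -> V -> V) : Prop := SlAction {
  sl_act_linl : forall v, linear (fun x => act x v);
  sl_act_linr : forall x, linear (act x);
  sl_act_bracket : forall x y v,
    act (sl_bracket x y) v = act x (act y v) - act y (act x v)
}.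

(* A module over sl_{r+1} (x) A with A = K[x^1, .., x^d]: [rho x P v] stands
   for (x (x) P) v.  A linear map out of the tensor product sl_{r+1} (x) A is
   the same as a map bilinear in (x, P), and brackets are determined by those
   of pure tensors. *)
Record current_action (K : fieldType) (r d : nat) (V : lmodType K)
    (rho : sl K r -> {mpoly K[d]} -> V -> V) : Prop := CurrentAction {
  cur_act_linl : forall P v, linear (fun x => rho x P v);
  cur_act_linm : forall x v, linear (fun P => rho x P v);
  cur_act_linr : forall x P, linear (rho x P);
  cur_act_bracket : forall x y P Q v,
    rho (sl_bracket x y) (P * Q) v = rho x P (rho y Q v) - rho y Q (rho x P v)
}.

Definition in_weight_space (K : fieldType) (r : nat) (V : lmodType K)
    (act : sl K r -> V -> V) (m : 'rV[int]_r) (v : V) : Prop :=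
  forall h : sl K r, in_cartan h -> act h v = weight_val m h *: v.

Definition integrable (K : fieldType) (r : nat) (V : lmodType K)
    (act : sl K r -> V -> V) : Prop :=
  exists D : seq 'rV[int]_r, [/\ uniq D,
    (forall v : V, exists u : 'rV[int]_r -> V,
        (forall m, m \in D -> in_weight_space act m (u m)) /\
        v = \sum_(m <- D) u m)
  & (forall u : 'rV[int]_r -> V,
        (forall m, m \in D -> in_weight_space act m (u m)) ->
        \sum_(m <- D) u m = 0 -> forall m, m \in D -> u m = 0)].

Definition generated_by (K : fieldType) (r d : nat) (V : lmodType K)
    (rho : sl K r -> {mpoly K[d]} -> V -> V) (v : V) : Prop :=
  forall S : V -> Prop,
    S v -> S 0 -> (forall a u w, S u -> S w -> S (a *: u + w)) ->
    (forall x P w, S w -> S (rho x P w)) ->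
    forall w, S w.

Record weyl_conditions (K : fieldType) (r d n : nat) (V : lmodType K)
    (rho : sl K r -> {mpoly K[d]} -> V -> V) (v : V) : Prop := WeylConditions {
  weyl_action : current_action rho;
  weyl_integrable : integrable (fun x => rho x 1);
  weyl_generated : generated_by rho v;
  weyl_nilp : forall x P, in_nilp x -> rho x P v = 0;
  weyl_first : forall (i : 'I_r) P, i = 0%N :> nat ->
    rho (coroot K i) P v = (n%:R * P.@[fun=> 0]) *: v;
  weyl_other : forall (i : 'I_r) P, (0 < i)%N -> rho (coroot K i) P v = 0
}.

Definition local_weyl_module (K : fieldType) (r d n : nat) (W : lmodType K)
    (rho : sl K r -> {mpoly K[d]} -> W -> W) (v : W) : Prop :=
  weyl_conditions n rho v /\
  forall (W' : lmodType K) (rho' : sl K r -> {mpoly K[d]} -> W' -> W') (v' : W'),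
    weyl_conditions n rho' v' ->
    exists f : {linear W -> W'},
      [/\ forall w', exists w, f w = w',
          forall x P w, f (rho x P w) = rho' x P (f w)
        & f v = v'].

Definition sl_isomorphic (K : fieldType) (r : nat) (V W : lmodType K)
    (actV : sl K r -> V -> V) (actW : sl K r -> W -> W) : Prop :=
  exists f : {linear V -> W},
    bijective f /\ forall x v, f (actV x v) = actW x (f v).

(* K[x_1, .., x_n], the variable x_i^a being 'X_(enum_rank (i, a)). *)
Notation multipoly K n d := {mpoly K[#|{: 'I_n * 'I_d}|]}.

Definition mvar (K : fieldType) (n d : nat) (i : 'I_n) (a : 'I_d)
    : multipoly K n d :=
  'X_(enum_rank (i, a)).

(* The algebra automorphism x_i^a |-> x_{s i}^a. *)
Definition multi_perm (K : fieldType) (n d : nat) (s : 'S_n)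
    (p : multipoly K n d) : multipoly K n d :=
  p \mPo [tuple mvar K (s (enum_val k).1) (enum_val k).2
          | k < #|{: 'I_n * 'I_d}|].

Fact multi_perm_linear (K : fieldType) (n d : nat) (s : 'S_n) :
  linear (@multi_perm K n d s).
Proof. exact: (linearP (comp_mpoly _)). Qed.

Fact multi_perm_monoid_morphism (K : fieldType) (n d : nat) (s : 'S_n) :
  monoid_morphism (@multi_perm K n d s).
Proof.
split; [exact: (rmorph1 (comp_mpoly _)) | exact: (rmorphM (comp_mpoly _))].
Qed.

HB.instance Definition _ (K : fieldType) (n d : nat) (s : 'S_n) :=
  GRing.isLinear.Build K (multipoly K n d) (multipoly K n d) *:%R
    (@multi_perm K n d s) (@multi_perm_linear K n d s).
HB.instance Definition _ (K : fieldType) (n d : nat) (s : 'S_n) :=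
  GRing.isMonoidMorphism.Build (multipoly K n d) (multipoly K n d)
    (@multi_perm K n d s) (@multi_perm_monoid_morphism K n d s).

Lemma multi_perm_var (K : fieldType) (n d : nat) (s : 'S_n) i a :
  multi_perm s (mvar K i a) = mvar K (s i) a :> multipoly K n d.
Proof.
by rewrite /multi_perm comp_mpolyXU -tnth_nth tnth_mktuple enum_rankK.
Qed.

Definition multi_invariant (K : fieldType) (n d : nat) (p : multipoly K n d)
    : Prop :=
  forall s : 'S_n, multi_perm s p = p.

(* The span of the products f * q with f invariant and vanishing at 0. *)
Definition coinv_ideal (K : fieldType) (n d : nat) : {pred multipoly K n d} :=
  fun p => `[< exists (k : nat) (f q : 'I_k -> multipoly K n d),
    (forall i, multi_invariant (f i) /\ (f i).@[fun=> 0] = 0) /\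
    p = \sum_(i < k) f i * q i >].

Fact coinv_ideal_submod_closed (K : fieldType) (n d : nat) :
  submod_closed (@coinv_ideal K n d).
Proof.
split=> [|a p p']; rewrite !unfold_in.
  apply/asboolP; exists 0%N, (fun=> 0), (fun=> 0).
  by split=> [[]|] //; rewrite big_ord0.
move=> /asboolP[k [f [q [hf ->]]]] /asboolP[k' [f' [q' [hf' ->]]]].
apply/asboolP; exists (k + k')%N.
exists (fun i => match split i with inl j => f j | inr j => f' j end).
exists (fun i => match split i with inl j => a *: q j | inr j => q' j end).
split; first by move=> i; case: (split i).
rewrite big_split_ord scaler_sumr /=; congr (_ + _); apply: eq_bigr => i _.
  by rewrite (unsplitK (inl i)) scalerAr.
by rewrite (unsplitK (inr i)).
Qed.

HB.instance Definition _ (K : fieldType) (n d : nat) :=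
  GRing.isSubmodClosed.Build K (multipoly K n d) (@coinv_ideal K n d)
    (@coinv_ideal_submod_closed K n d).

Definition coinvariants (K : fieldType) (n d : nat) : Type :=
  Quotient.quot (@coinv_ideal K n d).
HB.instance Definition _ (K : fieldType) (n d : nat) :=
  Choice.on (coinvariants K n d).
HB.instance Definition _ (K : fieldType) (n d : nat) :=
  GRing.Zmodule.on (coinvariants K n d).

Definition coinv_pi (K : fieldType) (n d : nat) (p : multipoly K n d)
    : coinvariants K n d :=
  \pi_(Quotient.quot (@coinv_ideal K n d)) p.
Definition coinv_repr (K : fieldType) (n d : nat) (c : coinvariants K n d)
    : multipoly K n d :=
  repr (c : Quotient.quot (@coinv_ideal K n d)).

Lemma coinv_reprK (K : fieldType) (n d : nat) :
  cancel (@coinv_repr K n d) (@coinv_pi K n d).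
Proof. exact: reprK. Qed.

Lemma coinv_piP (K : fieldType) (n d : nat) (p q : multipoly K n d) :
  reflect (coinv_pi p = coinv_pi q) (p - q \in @coinv_ideal K n d).
Proof. by rewrite Quotient.idealrBE; apply: eqP. Qed.

Fact coinv_pi_zmod_morphism (K : fieldType) (n d : nat) :
  zmod_morphism (@coinv_pi K n d).
Proof. exact: raddfB. Qed.

HB.instance Definition _ (K : fieldType) (n d : nat) :=
  GRing.isZmodMorphism.Build (multipoly K n d) (coinvariants K n d)
    (@coinv_pi K n d) (@coinv_pi_zmod_morphism K n d).

Definition coinv_scale (K : fieldType) (n d : nat) (a : K)
    (c : coinvariants K n d) : coinvariants K n d :=
  coinv_pi (a *: coinv_repr c).

Fact coinv_pi_scale (K : fieldType) (n d : nat) (a : K) (p : multipoly K n d) :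
  coinv_pi (a *: p) = coinv_scale a (coinv_pi p).
Proof.
apply/coinv_piP; rewrite -scalerBr rpredZ //.
by apply/coinv_piP; rewrite coinv_reprK.
Qed.

Section CoinvLmodule.
Variables (K : fieldType) (n d : nat).
Implicit Types (a b : K) (c : coinvariants K n d).

Fact coinv_scalerA a b c :
  coinv_scale a (coinv_scale b c) = coinv_scale (a * b) c.
Proof. by rewrite -[c]coinv_reprK -!coinv_pi_scale scalerA. Qed.
Fact coinv_scale1r : left_id 1 (@coinv_scale K n d).
Proof. by move=> c; rewrite -[c]coinv_reprK -coinv_pi_scale scale1r. Qed.
Fact coinv_scalerDr : right_distributive (@coinv_scale K n d) +%R.
Proof.
move=> a c c'; rewrite -[c]coinv_reprK -[c']coinv_reprK -raddfD.
by rewrite -!coinv_pi_scale scalerDr raddfD.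
Qed.
Fact coinv_scalerDl c : {morph (@coinv_scale K n d)^~ c : a b / a + b}.
Proof.
move=> a b; rewrite -[c]coinv_reprK -!coinv_pi_scale.
by rewrite scalerDl raddfD.
Qed.

HB.instance Definition _ :=
  GRing.Zmodule_isLmodule.Build K (coinvariants K n d)
    coinv_scalerA coinv_scale1r coinv_scalerDr coinv_scalerDl.

Fact coinv_pi_scalable : scalable (@coinv_pi K n d).
Proof. move=> a p; exact: coinv_pi_scale. Qed.

HB.instance Definition _ :=
  GRing.isScalable.Build K (multipoly K n d) (coinvariants K n d) *:%R
    (@coinv_pi K n d) coinv_pi_scalable.
End CoinvLmodule.

Fact mpoly_lrmorph_ext (K : fieldType) (N : nat)
    (f g : {lrmorphism {mpoly K[N]} -> {mpoly K[N]}}) :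
  (forall i, f 'X_i = g 'X_i) -> f =1 g.
Proof.
move=> fg; elim/mpolyind => [|a m q _ _ IH]; first by rewrite !linear0.
rewrite !(linearD, linearZ) /= IH mpolyXE_id !rmorph_prod; congr (_ *: _ + _).
by apply: eq_bigr => i _; rewrite !rmorphXn /= fg.
Qed.

Lemma multi_perm_mul (K : fieldType) (n d : nat) (s t : 'S_n)
    (p : multipoly K n d) :
  multi_perm s (multi_perm t p) = multi_perm (t * s)%g p.
Proof.
apply: (@mpoly_lrmorph_ext K _ (multi_perm s \o multi_perm t)
          (multi_perm (t * s)%g)) => k.
rewrite -(enum_valK k); case: (enum_val k) => i a /=.
by rewrite -/(mvar K i a) !multi_perm_var permM.
Qed.

Definition coinv_perm (K : fieldType) (n d : nat) (s : 'S_n)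
    (c : coinvariants K n d) : coinvariants K n d :=
  coinv_pi (multi_perm s (coinv_repr c)).

Lemma coinv_perm_pi (K : fieldType) (n d : nat) (s : 'S_n)
    (p : multipoly K n d) :
  coinv_perm s (coinv_pi p) = coinv_pi (multi_perm s p).
Proof.
apply/coinv_piP; rewrite -raddfB.
have /asboolP[k [f [q [hf ->]]]] :
    coinv_repr (coinv_pi p) - p \in @coinv_ideal K n d.
  by apply/coinv_piP; rewrite coinv_reprK.
apply/asboolP; exists k, f, (fun i => multi_perm s (q i)); split=> //.
rewrite (raddf_sum (multi_perm s)); apply: eq_bigr => i _.
rewrite /= (rmorphM (multi_perm s)) /=; congr (_ * _).
by have [/(_ s) + _] := hf i.
Qed.

Fact coinv_perm_linear (K : fieldType) (n d : nat) (s : 'S_n) :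
  linear (@coinv_perm K n d s).
Proof.
move=> a c c'; rewrite -[c]coinv_reprK -[c']coinv_reprK.
by rewrite -linearP !coinv_perm_pi !linearP.
Qed.
HB.instance Definition _ (K : fieldType) (n d : nat) (s : 'S_n) :=
  GRing.isLinear.Build K (coinvariants K n d) (coinvariants K n d) *:%R
    (@coinv_perm K n d s) (@coinv_perm_linear K n d s).

Notation word r n := {ffun 'I_n -> 'I_r.+1}.

(* Coordinates in the basis e_w = e_{w 0} (x) .. (x) e_{w (n-1)} of
   V_{r+1}^{(x) n}: F stands for the sum over w of e_w (x) F w. *)
Notation tensor_coinv K r n d := {ffun word r n -> coinvariants K n d}.

Definition pure_tensor (K : fieldType) (r n d : nat)
    (v : {ffun 'I_n -> 'cV[K]_r.+1}) (c : coinvariants K n d)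
    : tensor_coinv K r n d :=
  [ffun w : word r n => (\prod_(i < n) v i (w i) 0) *: c].

Definition upd (T : Type) (n : nat) (v : {ffun 'I_n -> T}) (k : 'I_n) (t : T)
    : {ffun 'I_n -> T} :=
  [ffun i => if i == k then t else v i].

Definition multilinear (K : fieldType) (r n d : nat) (U : lmodType K)
    (phi : {ffun 'I_n -> 'cV[K]_r.+1} -> coinvariants K n d -> U) : Prop :=
  (forall k v c, linear (fun x => phi (upd v k x) c)) /\
  (forall v, linear (phi v)).

Definition basis_tensor (K : fieldType) (r n : nat) (w : word r n)
    : {ffun 'I_n -> 'cV[K]_r.+1} :=
  [ffun i => delta_mx (w i) 0].

Fact linear_fun_sum (K : fieldType) (V U : lmodType K) (g : V -> U)
    (I : finType) (a : I -> K) (x : I -> V) :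
  linear g -> g (\sum_i a i *: x i) = \sum_i a i *: g (x i).
Proof.
move=> hg; apply: (big_ind2 (fun s t => g s = t)) => [|s t s' t' <- <-|i _].
- by have := hg (-1) 0 0; rewrite scaler0 addr0 scaleN1r addNr.
- by have := hg 1 s s'; rewrite !scale1r.
- have := hg (a i) (x i) 0; rewrite addr0 => ->.
  by have := hg (-1) 0 0; rewrite scaler0 addr0 scaleN1r addNr => ->; rewrite addr0.
Qed.

Lemma multilinear_ext (K : fieldType) (r n d : nat) (U : lmodType K)
    (phi psi : {ffun 'I_n -> 'cV[K]_r.+1} -> coinvariants K n d -> U) :
  multilinear phi -> multilinear psi ->
  (forall w c, phi (basis_tensor K w) c = psi (basis_tensor K w) c) ->
  forall v c, phi v c = psi v c.
Proof.
move=> hphi hpsi E v c.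
suff gen m : forall v : {ffun 'I_n -> 'cV[K]_r.+1}, (forall i : 'I_n, (m <= i)%N ->
    exists j, v i = delta_mx j 0) -> phi v c = psi v c.
  by apply: (gen n) => i; rewrite leqNgt ltn_ord.
elim: m => [|m IH] {}v hv.
  have ex i : exists j, v i == delta_mx j 0.
    by have [j ->] := hv i (leq0n _); exists j.
  suff -> : v = basis_tensor K [ffun i => xchoose (ex i)] by [].
  by apply/ffunP => i; rewrite !ffunE; apply/eqP/(xchooseP (ex i)).
have [nm|mn] := leqP n m.
  by apply: IH => i mi; have := leq_trans nm mi; rewrite leqNgt ltn_ord.
pose k := Ordinal mn.
have vE : v = upd v k (\sum_j v k j 0 *: delta_mx j 0).
  apply/ffunP => i; rewrite ffunE; case: eqP => // ->.
  by rewrite {1}[v k]matrix_sum_delta; apply: eq_bigr => j _; rewrite big_ord1.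
rewrite vE (linear_fun_sum _ _ (hphi.1 k v c)) (linear_fun_sum _ _ (hpsi.1 k v c)).
apply: eq_bigr => j _; congr (_ *: _); apply: IH => i mi; rewrite ffunE.
case: eqP => [_|/eqP ik]; first by exists j.
by apply: hv; rewrite ltn_neqAle mi andbT; apply: contra ik => /eqP mi'; rewrite -val_eqE /= mi'.
Qed.

Lemma pure_tensor_multilinear (K : fieldType) (r n d : nat) :
  multilinear (@pure_tensor K r n d).
Proof.
split=> [k v c a x y|v a c c']; apply/ffunP => w; rewrite !ffunE; last first.
  by rewrite scalerDr !scalerA mulrC.
rewrite scalerA -scalerDl; congr (_ *: _).
rewrite ![\prod_(_ < _) _](bigD1 k isT) /= !ffunE eqxx !mxE mulrDl mulrA.
by congr (_ * _ + _ * _); apply: eq_bigr => i /negPf ik; rewrite !ffunE ik.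
Qed.

Lemma tensor_decomp (K : fieldType) (r n d : nat) (F : tensor_coinv K r n d) :
  F = \sum_(w : word r n) pure_tensor (basis_tensor K w) (F w).
Proof.
apply/ffunP => w; rewrite sum_ffunE (bigD1 w) //= ffunE big1 ?scale1r; last first.
  by move=> i _; rewrite ffunE mxE !eqxx.
rewrite big1 ?addr0 // => u uw; rewrite ffunE.
have [i wu] : exists i, w i != u i.
  apply/existsP; rewrite -negb_forall; apply: contra uw => /forallP uw.
  by apply/eqP/ffunP => i; rewrite (eqP (uw i)).
by rewrite (bigD1 i) //= ffunE mxE (negPf wu) mul0r scale0r.
Qed.

Lemma pure_tensor_universal (K : fieldType) (r n d : nat) (U : lmodType K)
    (phi : {ffun 'I_n -> 'cV[K]_r.+1} -> coinvariants K n d -> U) :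
  multilinear phi ->
  exists2 f : tensor_coinv K r n d -> U,
    linear f /\ (forall v c, f (pure_tensor v c) = phi v c)
  & forall g : tensor_coinv K r n d -> U,
      linear g -> (forall v c, g (pure_tensor v c) = phi v c) -> g =1 f.
Proof.
move=> hphi; pose f (F : tensor_coinv K r n d) :=
  \sum_(w : word r n) phi (basis_tensor K w) (F w).
have flin : linear f.
  move=> a F G; rewrite /f scaler_sumr -big_split; apply: eq_bigr => w _.
  by rewrite !ffunE; apply: hphi.2.
have sumE g : linear g -> forall F : tensor_coinv K r n d,
    g F = \sum_(w : word r n) g (pure_tensor (basis_tensor K w) (F w)) :> U.
  move=> hg F; rewrite {1}[F]tensor_decomp.
  under eq_bigr do rewrite -[pure_tensor _ _]scale1r.
  by rewrite (linear_fun_sum (fun=> 1) _ hg); apply: eq_bigr => w _; rewrite scale1r.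
exists f; last first.
  by move=> g hg E F; rewrite sumE //; apply: eq_bigr => w _; rewrite E.
split=> //; apply: multilinear_ext => // [|w c].
  have [h1 h2] := pure_tensor_multilinear K r n d.
  by split=> [k v c a x y|v a c c']; rewrite (h1, h2) flin.
rewrite /f (bigD1 w) //= ffunE big1 ?scale1r => [|i _]; last first.
  by rewrite ffunE mxE !eqxx.
rewrite big1 ?addr0 // => u uw.
have [i wu] : exists i, u i != w i.
  apply/existsP; rewrite -negb_forall; apply: contra uw => /forallP uw.
  by apply/eqP/ffunP => i; rewrite (eqP (uw i)).
rewrite ffunE (bigD1 i) //= ffunE mxE (negPf wu) mul0r scale0r.
have := hphi.2 (basis_tensor K u) (-1) 0 0.
by rewrite scaler0 addr0 scaleN1r addNr.
Qed.

Definition tensor_act (K : fieldType) (r n d : nat) (x : sl K r)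
    (F : tensor_coinv K r n d) : tensor_coinv K r n d :=
  [ffun w : word r n => \sum_(k < n) \sum_(j < r.+1) x (w k) j *: F (upd w k j)].

Definition tensor_perm (K : fieldType) (r n d : nat) (s : 'S_n)
    (F : tensor_coinv K r n d) : tensor_coinv K r n d :=
  [ffun w : word r n => coinv_perm s (F [ffun i => w (s i)])].

Lemma tensor_act_pure (K : fieldType) (r n d : nat) (x : sl K r)
    (v : {ffun 'I_n -> 'cV[K]_r.+1}) (c : coinvariants K n d) :
  tensor_act x (pure_tensor v c) =
  \sum_(k < n) pure_tensor (upd v k (sl_mx x *m v k)) c.
Proof.
apply/ffunP => w; rewrite sum_ffunE ffunE; apply: eq_bigr => k _.
rewrite ffunE (bigD1 k) //= ffunE eqxx mxE mulr_suml scaler_suml.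
apply: eq_bigr => j _; rewrite ffunE scalerA (bigD1 k) //= ffunE eqxx mulrA.
congr (_ * _ *: _); apply: eq_bigr => i /negPf ik.
by rewrite !ffunE ik.
Qed.

(* s moves the k-th factor, like the k-th multivariable, to position s k. *)
Lemma tensor_perm_pure (K : fieldType) (r n d : nat) (s : 'S_n)
    (v : {ffun 'I_n -> 'cV[K]_r.+1}) (c : coinvariants K n d) :
  tensor_perm s (pure_tensor v c) =
  pure_tensor [ffun i => v (s^-1%g i)] (coinv_perm s c).
Proof.
apply/ffunP => w; rewrite !ffunE linearZ /=; congr (_ *: _).
rewrite [RHS](reindex_inj (@perm_inj _ s)) /=.
by apply: eq_bigr => i _; rewrite !ffunE permK.
Qed.

Definition perm_invariant (K : fieldType) (r n d : nat)
    : {pred tensor_coinv K r n d} :=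
  fun F => [forall s : 'S_n, tensor_perm s F == F].

Fact tensor_perm_linear (K : fieldType) (r n d : nat) (s : 'S_n) :
  linear (@tensor_perm K r n d s).
Proof. by move=> a F G; apply/ffunP => w; rewrite !ffunE linearP. Qed.

Fact tensor_act_linear (K : fieldType) (r n d : nat) (x : sl K r) :
  linear (@tensor_act K r n d x).
Proof.
move=> a F G; apply/ffunP => w; rewrite !ffunE scaler_sumr -big_split /=.
apply: eq_bigr => k _; rewrite scaler_sumr -big_split /=.
apply: eq_bigr => j _; by rewrite !ffunE scalerDr !scalerA mulrC.
Qed.

Fact updK (T : Type) (n : nat) (v : {ffun 'I_n -> T}) k s t :
  upd (upd v k s) k t = upd v k t.
Proof. by apply/ffunP => i; rewrite !ffunE; case: eqP. Qed.

Fact updC (T : Type) (n : nat) (v : {ffun 'I_n -> T}) k l s t :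
  k != l -> upd (upd v k s) l t = upd (upd v l t) k s.
Proof.
move=> kl; apply/ffunP => i; rewrite !ffunE.
by case: eqP => // ->; rewrite eq_sym (negPf kl).
Qed.

Lemma tensor_act_sl (K : fieldType) (r n d : nat) :
  sl_action (@tensor_act K r n d).
Proof.
split=> [F a x y|x|x y F]; last 2 first.
- exact: tensor_act_linear.
- have actS z I (s : seq I) (G : I -> tensor_coinv K r n d) :
      tensor_act z (\sum_(i <- s) G i) = \sum_(i <- s) tensor_act z (G i).
    have h := @tensor_act_linear K r n d z.
    apply: (big_morph (tensor_act z)) => [F1 F2|].
      by have := h 1 F1 F2; rewrite !scale1r.
    by have := h (-1) 0 0; rewrite scaler0 addr0 scaleN1r addNr.
  pose T (x y : sl K r) (v : {ffun 'I_n -> 'cV[K]_r.+1})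
      (c : coinvariants K n d) :=
    \sum_(k < n) \sum_(l < n | l != k)
      pure_tensor (upd (upd v k (y *m v k)) l (x *m v l)) c.
  have actT (z t : sl K r) v c : tensor_act z (tensor_act t (pure_tensor v c)) =
      \sum_(k < n) pure_tensor (upd v k (z *m (t *m v k))) c + T z t v c.
    rewrite tensor_act_pure actS -big_split; apply: eq_bigr => k _.
    rewrite tensor_act_pure (bigD1 k) //= updK ffunE eqxx; congr (_ + _).
    by apply: eq_bigr => l /negPf lk; rewrite ffunE lk.
  have TC z t v c : T z t v c = T t z v c.
    rewrite /T (exchange_big_dep xpredT) //=; apply: eq_bigr => k _.
    by apply: eq_big => [l|l kl]; [rewrite eq_sym | rewrite updC // eq_sym].
  rewrite [F]tensor_decomp !actS -sumrB; apply: eq_bigr => w _.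
  move: (basis_tensor K w) (F w) => v c.
  rewrite !actT TC opprD addrACA subrr addr0 -sumrB tensor_act_pure.
  apply: eq_bigr => k _; rewrite /= mulmxBl -!mulmxA.
  have [h _] := pure_tensor_multilinear K r n d.
  have E := h k v c (-1) (y *m (x *m v k)) (x *m (y *m v k)).
  by rewrite /= !scaleN1r in E; rewrite [in LHS]addrC E [LHS]addrC.
apply/ffunP => w; rewrite !ffunE scaler_sumr -big_split; apply: eq_bigr => k _.
rewrite scaler_sumr -big_split; apply: eq_bigr => j _.
by rewrite /= !mxE scalerDl scalerA.
Qed.

Fact perm_invariant_submod_closed (K : fieldType) (r n d : nat) :
  submod_closed (@perm_invariant K r n d).
Proof.
split=> [|a F G]; rewrite !unfold_in.
  by apply/forallP => s; apply/eqP/ffunP => w; rewrite !ffunE linear0.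
move=> /forallP hF /forallP hG; apply/forallP => s.
by rewrite tensor_perm_linear (eqP (hF s)) (eqP (hG s)).
Qed.

HB.instance Definition _ (K : fieldType) (r n d : nat) :=
  GRing.isSubmodClosed.Build K (tensor_coinv K r n d) (@perm_invariant K r n d)
    (@perm_invariant_submod_closed K r n d).

Record invariants (K : fieldType) (r n d : nat) : Type := Invariants {
  inv_tensor :> tensor_coinv K r n d;
  _ : inv_tensor \in @perm_invariant K r n d
}.

HB.instance Definition _ (K : fieldType) (r n d : nat) :=
  [isSub for @inv_tensor K r n d].
HB.instance Definition _ (K : fieldType) (r n d : nat) :=
  [Choice of invariants K r n d by <:].
HB.instance Definition _ (K : fieldType) (r n d : nat) :=
  [SubChoice_isSubLmodule of invariants K r n d by <:].

Fact inv_act_subproof (K : fieldType) (r n d : nat) (x : sl K r)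
    (F : invariants K r n d) :
  tensor_act x F \in @perm_invariant K r n d.
Proof.
case: F => F /= /forallP hF; apply/forallP => s; apply/eqP/ffunP => w.
rewrite !ffunE linear_sum /= [RHS](reindex_inj (@perm_inj _ s)) /=.
apply: eq_bigr => k _; rewrite linear_sum; apply: eq_bigr => j _.
rewrite linearZ /= ffunE; congr (_ *: _).
rewrite -[in RHS](eqP (hF s)) ffunE; congr (coinv_perm s (F _)).
by apply/ffunP => i; rewrite !ffunE (inj_eq perm_inj).
Qed.

Definition inv_act (K : fieldType) (r n d : nat) (x : sl K r)
    (F : invariants K r n d) : invariants K r n d :=
  Invariants (inv_act_subproof x F).

Lemma inv_act_sl (K : fieldType) (r n d : nat) : sl_action (@inv_act K r n d).
Proof.
have [h1 h2 h3] := tensor_act_sl K r n d.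
split=> [F a x y|x a F G|x y F]; apply: val_inj => /=.
- exact: h1.
- exact: h2.
- exact: h3.
Qed.

(* Main.v *)
Require Import Defs.
From HB Require Import structures.
From mathcomp Require Import all_boot all_order all_algebra all_fingroup.
From mathcomp Require Import boolp reals.
From mathcomp Require Import ring ssrcomplements mpoly.
From mathcomp.real_closed Require Import complex.

Set Implicit Arguments.
Unset Strict Implicit.
Unset Printing Implicit Defensive.

Import Order.TTheory GRing.Theory Num.Theory.
Local Open Scope ring_scope.

(** Write [A] for the polynomials in one multivariable and [M] for the
    invariants of [V^{(x) n} (x) D]. The algebra gl_{r+1} (x) A acts on [M]: the
    element [x (x) P] acts by [x] on one tensor factor and multiplies by [P] in
    the multivariable of the same index, summed over the factors; in particular
    [1 (x) P] acts by the scalar [n P(0)], because power sums are scalars modulo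
    the coinvariant ideal. It is shown that [M], with [e_0 (x) .. (x) e_0 (x) 1]
    as generator, is itself a local Weyl module; as local Weyl modules are
    unique ([local_weyl_unique]), both parts of the theorem follow.

    [M] satisfies the defining relations by direct computation, apart from
    cyclicity, which rests on polarization ([polarization],
    [invariant_tensor_gen]): the symmetrizations of decomposable tensors are
    reached from [e_0 (x) .. (x) e_0] by changing one slot at a time with the
    operators [E_i0 (x) P].

    For the universal property let [W] be any module with the defining
    relations and generator [v]. Extend the action to gl_{r+1} (x) A by letting
    [1 (x) P] act by [n P(0)] ([gl_act]). This is an action of the commutator
    Lie algebra of the associative algebra [B] of matrices over [A], and so one
    can form normally ordered products [nop [:: X_1; ..; X_k]]: symmetric
    functions of [X_1, .., X_k] in [B] which on a tensor power would be the sum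
    of the [X_1 (x) .. (x) X_k] placed in distinct factors. By construction
      [X . nop [:: X_1; ..; X_k] =
         nop [:: X, X_1; ..; X_k] + sum_i nop [:: X_1; ..; X X_i; ..; X_k]].
    The relations and sl_2-theory show that [E_ij (x) P] kills [v] for every
    nonzero [j] ([gl_act_kill]) and that [E_10 ^ (n + 1) v = 0]
    ([gl_act_lowering]). Polarizing the latter relation, every normally ordered
    product of [n + 1] elements of the first column of [B] kills [v]
    ([slot_nop_overflow]). Hence
      [e_{i_1} P_1 (x) .. (x) e_{i_n} P_n |->
         nop [:: E_{i_1 0} P_1; ..; E_{i_n 0} P_n] v]
    is equivariant ([tensor_map_act]). Since power sums act by scalars on [W]
    and generate the invariant polynomials, the map factors through the
    coinvariants ([tensor_map_invariant], [tensor_map_coinv]); restricted to [M]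
    and divided by [n!] it sends generator to generator. *)

(** * Linear functions given as predicates *)

Section LinearFunctions.
Variables (K : fieldType) (V U : lmodType K) (g : V -> U).
Hypothesis g_lin : linear g.

Lemma lin0 : g 0 = 0.
Proof. by have := g_lin (-1) 0 0; rewrite scaler0 addr0 scaleN1r addNr. Qed.

Lemma linD : {morph g : x y / x + y}.
Proof. by move=> x y; have := g_lin 1 x y; rewrite !scale1r. Qed.

Lemma linZ a : {morph g : x / a *: x}.
Proof. by move=> x; have := g_lin a x 0; rewrite lin0 !addr0. Qed.

Lemma linN : {morph g : x / - x}.
Proof. by move=> x; rewrite -scaleN1r linZ scaleN1r. Qed.

Lemma linB : {morph g : x y / x - y}.
Proof. by move=> x y; rewrite linD linN. Qed.

Lemma lin_sum I (s : seq I) (P : pred I) (F : I -> V) :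
  g (\sum_(i <- s | P i) F i) = \sum_(i <- s | P i) g (F i).
Proof. exact: (big_morph g linD lin0). Qed.

End LinearFunctions.

(** * Acting on one slot of a list *)

(** [slotwise f s] lists the lists obtained from [s] by applying [f] to exactly
    one of its entries; summing over it is how a derivation acts on a product
    of the entries of [s]. *)
Fixpoint slotwise (C : Type) (f : C -> C) (s : seq C) : seq (seq C) :=
  if s is x :: s' then (f x :: s') :: map (cons x) (slotwise f s') else [::].

Section Slotwise.
Variables (C : Type) (f : C -> C).
Implicit Types (s t : seq C).

Lemma slotwise_cat s t :
  slotwise f (s ++ t) =
  [seq u ++ t | u <- slotwise f s] ++ [seq s ++ u | u <- slotwise f t].
Proof.
elim: s => [|x s IH] /=; first by rewrite map_id.
by rewrite IH map_cat -!map_comp.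
Qed.

Lemma big_slotwise_cons (U : zmodType) (G : seq C -> U) x s :
  \sum_(t <- slotwise f (x :: s)) G t =
  G (f x :: s) + \sum_(t <- slotwise f s) G (x :: t).
Proof. by rewrite /= big_cons big_map. Qed.

Lemma big_slotwise_mid (U : zmodType) (G : seq C -> U) s x t :
  \sum_(u <- slotwise f (s ++ x :: t)) G u =
  \sum_(u <- slotwise f s) G (u ++ x :: t) + G (s ++ f x :: t)
  + \sum_(u <- slotwise f t) G (s ++ x :: u).
Proof.
by rewrite slotwise_cat big_cat /= big_map big_cons !big_map addrA.
Qed.

Lemma eq_big_slotwise (U : zmodType) (G H : seq C -> U) s :
  (forall t, size t = size s -> G t = H t) ->
  \sum_(t <- slotwise f s) G t = \sum_(t <- slotwise f s) H t.
Proof.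
elim: s G H => [|x s IH] G H GH; first by rewrite !big_nil.
rewrite !big_slotwise_cons GH //; congr (_ + _); apply: IH => t st.
by rewrite GH //= st.
Qed.

Lemma slotwise_map (I : eqType) (b : I -> C) (s : seq I) :
  uniq s ->
  slotwise f (map b s) =
  [seq [seq if j == i then f (b i) else b j | j <- s] | i <- s].
Proof.
elim: s => //= x s IH /andP[xs us]; rewrite eqxx IH //; congr (_ :: _).
  congr (_ :: _); apply/eq_in_map => j js; case: eqP => // jx.
  by rewrite -jx js in xs.
rewrite -map_comp; apply/eq_in_map => i si /=; congr (_ :: _).
by case: eqP => // xi; rewrite xi si in xs.
Qed.

Lemma big_slotwise_ind (U : zmodType) (S : U -> Prop) (G : seq C -> U) s :
  S 0 -> (forall u w, S u -> S w -> S (u + w)) ->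
  (forall t, size t = size s -> S (G t)) -> S (\sum_(t <- slotwise f s) G t).
Proof.
move=> S0 SD; elim: s G => [|x s IH] G SG; first by rewrite big_nil.
rewrite big_slotwise_cons; apply: SD; first exact: SG.
by apply: IH => t st; apply: SG; rewrite /= st.
Qed.

Lemma big_slotwise_nseq (U : zmodType) (G : seq C -> U) (c : C) k :
  (forall s x t, (size s + size t)%N = k.-1 -> G (s ++ x :: t) = G (x :: s ++ t)) ->
  \sum_(t <- slotwise f (nseq k c)) G t = G (f c :: nseq k.-1 c) *+ k.
Proof.
move=> sym; suff H m l : (l + m)%N = k ->
    \sum_(t <- slotwise f (nseq m c)) G (nseq l c ++ t)
    = G (f c :: nseq k.-1 c) *+ m.
  by have := H k 0%N (add0n _).
elim: m l => [|m IH] l lk; first by rewrite big_nil mulr0n.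
have kE : k.-1 = (l + m)%N by rewrite -lk addnS.
rewrite /= big_cons big_map sym; last by rewrite !size_nseq kE.
rewrite mulrS -nseqD -kE; congr (_ + _).
rewrite -(IH l.+1) ?addSnnS //; apply: eq_bigr => t _.
by rewrite -cat_rcons -cats1 -[[:: c]]/(nseq 1 c) -nseqD addn1.
Qed.

End Slotwise.

(** The polarization principle. A symmetric function of [N] arguments takes
    values in a subspace [S] as soon as [S] contains its value at one constant
    list [c, .., c] and, for every [b], is stable under an operator that acts
    on the values through a substitution sending [c] to [b] in one slot at a
    time. *)
Lemma polarization (K : numFieldType) (U : lmodType K) (C : Type)
    (T : seq C -> U) (S : U -> Prop) (N : nat) (c : C)
    (f : C -> C -> C) (op : C -> U -> U) :
  S 0 -> (forall a u w, S u -> S w -> S (a *: u + w)) ->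
  (forall b u, S u -> S (op b u)) ->
  (forall b, f b c = b) ->
  (forall s b t, (size s + size t).+1%N = N -> T (s ++ b :: t) = T (b :: s ++ t)) ->
  (forall b s, size s = N -> op b (T s) = \sum_(t <- slotwise (f b) s) T t) ->
  S (T (nseq N c)) -> forall s, size s = N -> S (T s).
Proof.
move=> S0 Slin Sop fc sym opT Sc.
have SN u : S u -> S (- u) by move=> Su; rewrite -scaleN1r -[_ *: _]addr0; apply: Slin.
have SD u w : S u -> S w -> S (u + w) by move=> *; rewrite -[u]scale1r; apply: Slin.
suff H s k : (size s + k)%N = N -> S (T (s ++ nseq k c)).
  by move=> s sN; have := H s 0%N; rewrite addn0 cats0; apply.
have [m sm] := ubnP (size s); elim: m s k sm => // m IH [|b s] k sm sk.
  by move: sk; rewrite add0n => ->.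
have sk' : (size s + k.+1)%N = N by rewrite -sk addSnnS.
have /(Sop b) : S (T (s ++ nseq k.+1 c)) by apply: IH.
rewrite opT ?size_cat ?size_nseq // slotwise_cat big_cat !big_map /=.
have -> : \sum_(t <- slotwise (f b) (nseq k.+1 c)) T (s ++ t) =
    T (b :: s ++ nseq k c) *+ k.+1.
  rewrite -{2}(fc b) (@big_slotwise_nseq _ _ _ (fun t => T (s ++ t)) c k.+1) /=.
    by rewrite sym // size_nseq -sk' addnS.
  move=> s' x t' hs; rewrite catA !sym ?catA // ?size_cat -?addnA hs -sk' addnS //.
move=> h; set u := T _ in h *.
set w := \sum_(_ <- _) _ in h.
have Sw : S w.
  apply: (@big_slotwise_ind C (f b) U S (fun t => T (t ++ nseq k.+1 c))) => // t st.
  by apply: IH; rewrite st.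
have Su : S (u *+ k.+1).
  by rewrite -[_ *+ _](addKr w) addrC; apply: (SD) => //; apply: (SN).
rewrite -[u](scalerK (_ : k.+1%:R != 0 :> K)) ?pnatr_eq0 //.
by rewrite scaler_nat -[_ *: _]addr0; apply: Slin.
Qed.

(** * Normally ordered products *)

(* Two identities in abelian groups, used to regroup sums below. *)
Fact subr_regroup (V : zmodType) (x y a b p q : V) :
  x + a + (b + p) - (y + b + (a + q)) = (x - y) + (p - q).
Proof.
have -> : x + a + (b + p) = (a + b) + (x + p) by rewrite (AC (2*2) ((2*3)*(1*4))).
have -> : y + b + (a + q) = (a + b) + (y + q) by rewrite (AC (2*2) ((3*2)*(1*4))).
by rewrite opprD addrACA subrr add0r opprD addrACA.
Qed.

Fact subr_exchange (V : zmodType) (a a' c c' d e f f' g g' : V) :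
  a - a' = c - c' -> f' - f = g - g' ->
  a - d - ((c - g) + (e - f)) = a' - e - ((c' - g') + (d - f')).
Proof.
move=> /(canRL (subrK _)) -> /(canRL (subrK _)) ->.
rewrite !opprD !opprK.
rewrite [LHS](AC (4*(2*2)) ((1*5)*(2*3*4*6*7*8))) /= subrr add0r.
by rewrite [RHS](AC (2*(2*(1*3))) ((4*7)*(3*1*5*6*2*8))) /= subrr add0r.
Qed.

Section NormalOrder.
Variables (K : fieldType) (W : lmodType K) (B : Type) (mul : B -> B -> B).
Variable L : B -> W -> W.
Hypothesis mulA : associative mul.
Hypothesis L_lin : forall X, linear (L X).
Hypothesis L_bracket : forall X Y u,
  L X (L Y u) - L Y (L X u) = L (mul X Y) u - L (mul Y X) u.

Implicit Types (X Y : B) (s t : seq B) (u : W).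

(** The normally ordered product of [s] acting on [u]: in a tensor power of a
    [B]-module it would be the sum, over all ways of placing the entries of
    [s] in pairwise distinct tensor factors, of the resulting operators. The
    recursion subtracts from [L X (nop s u)] the terms in which [X] falls on a
    factor already occupied; the first argument is the length of the list. *)
Fixpoint nop_rec (k : nat) s u : W :=
  match k, s with
  | k'.+1, X :: s' =>
    L X (nop_rec k' s' u) - \sum_(t <- slotwise (mul X) s') nop_rec k' t u
  | _, _ => u
  end.

Definition nop s u : W := nop_rec (size s) s u.

Lemma nop_cons X s u :
  nop (X :: s) u = L X (nop s u) - \sum_(t <- slotwise (mul X) s) nop t u.
Proof.
by rewrite /nop /=; congr (_ - _); apply: eq_big_slotwise => t ->.
Qed.

Lemma L_nop X s u :
  L X (nop s u) = nop (X :: s) u + \sum_(t <- slotwise (mul X) s) nop t u.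
Proof. by rewrite nop_cons subrK. Qed.

(** Left multiplications commute up to left multiplication by the commutator,
    also when they are extended to lists as derivations. *)
Lemma slotwise_bracket (G : seq B -> W) X Y s :
  \sum_(t <- slotwise (mul Y) s) \sum_(t' <- slotwise (mul X) t) G t'
  - \sum_(t <- slotwise (mul X) s) \sum_(t' <- slotwise (mul Y) t) G t'
  = \sum_(t <- slotwise (mul (mul X Y)) s) G t
    - \sum_(t <- slotwise (mul (mul Y X)) s) G t.
Proof.
elim: s G => [|Z s IH] G; first by rewrite !big_nil !subrr.
rewrite !(big_slotwise_cons, mulA).
under [X in _ + X - _]eq_bigr do rewrite big_slotwise_cons.
under [X in _ - (_ + X)]eq_bigr do rewrite big_slotwise_cons.
rewrite !big_split /=.
rewrite subr_regroup (IH (fun t => G (Z :: t))).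
by rewrite [in RHS]opprD [RHS]addrACA.
Qed.

Lemma nop_swap X Y s u : nop [:: X, Y & s] u = nop [:: Y, X & s] u.
Proof.
have E X' Y' : nop [:: X', Y' & s] u =
    L X' (L Y' (nop s u)) - L X' (\sum_(t <- slotwise (mul Y') s) nop t u)
    - (L (mul X' Y') (nop s u) - \sum_(t <- slotwise (mul (mul X' Y')) s) nop t u
    + (L Y' (\sum_(t <- slotwise (mul X') s) nop t u)
       - \sum_(t <- slotwise (mul X') s) \sum_(t' <- slotwise (mul Y') t) nop t' u)).
  rewrite nop_cons big_slotwise_cons !nop_cons (linB (L_lin X')).
  under [X in _ - (_ + X)]eq_bigr do rewrite nop_cons.
  by rewrite sumrB -(lin_sum (L_lin Y')).
rewrite !E; apply: subr_exchange; first exact: L_bracket.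
exact: (slotwise_bracket (nop^~ u) X Y s).
Qed.

Lemma nop_front s1 X s2 u : nop (s1 ++ X :: s2) u = nop (X :: s1 ++ s2) u.
Proof.
have [m sm] := ubnP (size s1 + size s2).
elim: m s1 X s2 sm => // m IH [|Y s1] X s2 sm //=.
rewrite nop_swap [LHS]nop_cons [RHS]nop_cons IH //; congr (_ - _).
rewrite big_slotwise_cons big_slotwise_mid slotwise_cat big_cat !big_map /=.
rewrite addrCA addrA; congr (_ + _ + _).
- apply: eq_big_slotwise => t st; apply: IH.
  by rewrite st.
- exact: IH.
- apply: eq_big_slotwise => t st; apply: IH.
  by rewrite st.
Qed.

(** The entries of a normally ordered product can be permuted, so any one of
    them may be taken to act first: if it lies in a left ideal [J] annihilating
    [v], the product annihilates [v]. *)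
Lemma nop_ideal (J : B -> Prop) v s1 Y s2 :
  (forall X Z, J Z -> J (mul X Z)) -> (forall Z, J Z -> L Z v = 0) ->
  J Y -> nop (s1 ++ Y :: s2) v = 0.
Proof.
move=> Jmul Jv JY; suff H s Z : J Z -> nop (rcons s Z) v = 0.
  rewrite nop_front -[s1 ++ s2]cats0 -nop_front cats1.
  exact: H.
have [m sm] := ubnP (size s); elim: m s Z sm => // m IH [|X s] Z sm JZ /=.
  by rewrite nop_cons big_nil subr0 Jv.
rewrite nop_cons -cats1 big_slotwise_mid big_nil addr0 cats1 IH //.
rewrite (lin0 (L_lin X)) sub0r cats1 IH ?addr0 //; last exact: Jmul.
rewrite (@eq_big_slotwise _ _ _ _ (fun=> 0)) ?big1 ?oppr0 // => t st.
by rewrite cats1 IH // st.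
Qed.

Lemma nop_idem c (a : K) v k : mul c c = c -> L c v = a *: v ->
  nop (nseq k c) v = (\prod_(i < k) (a - i%:R)) *: v.
Proof.
move=> cc cv; elim: k => [|k IH]; first by rewrite big_ord0 scale1r.
rewrite /= nop_cons big_slotwise_nseq => [|s x t _]; last exact: nop_front.
rewrite cc IH (linZ (L_lin c)) cv big_ord_recr /= scalerA mulrBr scalerBl.
case: k IH => [|k] IH; first by rewrite mulr0 scale0r mulr0n.
by rewrite /= -/(nseq k.+1 c) IH mulr_natr scalerMnl.
Qed.
End NormalOrder.

(** * Finiteness of weights and lowering operators *)

Section Sl2.
Variables (K : numFieldType) (W : lmodType K) (e f h : W -> W) (evs : seq K).
Hypotheses (e_lin : linear e) (f_lin : linear f).
Hypothesis ef : forall u, e (f u) - f (e u) = h u.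
Hypothesis hf : forall u, h (f u) - f (h u) = - 2%:R *: f u.
Hypothesis h_eigen : forall (c : K) u, h u = c *: u -> u != 0 -> c \in evs.

Lemma sl2_weight (a : K) u k : h u = a *: u ->
  h (iter k f u) = (a - 2%:R * k%:R) *: iter k f u.
Proof.
move=> hu; elim: k => [|k IH]; first by rewrite mulr0 subr0.
rewrite iterS -[h _](subrK (f (h (iter k f u)))) hf IH (linZ f_lin) -scalerDl.
by congr (_ *: _); rewrite -natr1; ring.
Qed.

Lemma sl2_raise (a : K) u k : e u = 0 -> h u = a *: u ->
  e (iter k.+1 f u) = (k.+1%:R * (a - k%:R)) *: iter k f u.
Proof.
move=> eu hu; elim: k => [|k IH].
  by rewrite /= -[e _](subrK (f (e u))) ef eu (lin0 f_lin) addr0 hu mul1r subr0.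
rewrite iterS -[e _](subrK (f (e (iter k.+1 f u)))) ef IH (linZ f_lin).
rewrite (sl2_weight _ hu) -iterS -scalerDl; congr (_ *: _).
by rewrite -!natr1; ring.
Qed.

Lemma sl2_nilpotent (a : K) u : h u = a *: u -> exists k, iter k f u = 0.
Proof.
move=> hu; apply: contrapT => nf.
pose s := [seq a - 2%:R * k%:R | k <- iota 0 (size evs).+1].
have us : uniq s.
  rewrite map_inj_uniq ?iota_uniq // => k l /addrI/oppr_inj/mulfI.
  by rewrite pnatr_eq0 => /(_ isT)/eqP; rewrite eqr_nat => /eqP.
have /(uniq_leq_size us) : {subset s <= evs}.
  move=> c /mapP[k _ ->]; apply: (h_eigen (sl2_weight k hu)).
  by apply/eqP => k0; apply: nf; exists k.
by rewrite size_map size_iota ltnn.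
Qed.

(** The vector [f ^ (m + 1) v] is killed by [e] and has negative weight, so
    finiteness of the weights forces it to vanish. *)
Lemma sl2_lowering (m : nat) v :
  e v = 0 -> h v = m%:R *: v -> iter m.+1 f v = 0.
Proof.
move=> ev hv; set u := iter m.+1 f v.
pose a : K := m%:R - 2%:R * m.+1%:R.
have hu : h u = a *: u by apply: sl2_weight.
have eu : e u = 0 by rewrite /u (sl2_raise m ev hv) subrr mulr0 scale0r.
have [k] := sl2_nilpotent hu; elim: k => // k IH k0; apply: IH.
have := sl2_raise k eu hu; rewrite k0 (lin0 e_lin) => /esym/eqP.
rewrite scaler_eq0 mulf_eq0 pnatr_eq0 /= => /orP[/eqP ak|/eqP //].
have : (m + k + 2)%:R = 0 :> K.
  by rewrite -oppr0 -ak /a !natrD -natr1; ring.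
by move/eqP; rewrite pnatr_eq0 addn2.
Qed.

End Sl2.

(** * Tensors with polynomial coefficients *)

(** [emb k P] is [P] written in the [k]-th multivariable. *)
HB.lock Definition emb (K : fieldType) (n d : nat) (k : 'I_n) (P : {mpoly K[d]})
    : multipoly K n d :=
  P \mPo [tuple mvar K k a | a < d].

Section Embedding.
Variables (K : fieldType) (n d : nat).
Implicit Types (k : 'I_n) (P Q : {mpoly K[d]}).
Local Notation emb := (@emb K n d).

Fact emb_linear k : linear (emb k).
Proof. by rewrite emb.unlock; apply: (linearP (comp_mpoly _)). Qed.

Fact emb_monoid_morphism k : monoid_morphism (emb k).
Proof.
rewrite emb.unlock; split; [exact: (rmorph1 (comp_mpoly _)) | exact: (rmorphM (comp_mpoly _))].
Qed.

HB.instance Definition _ k :=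
  GRing.isLinear.Build K {mpoly K[d]} (multipoly K n d) *:%R (emb k)
    (emb_linear k).
HB.instance Definition _ k :=
  GRing.isMonoidMorphism.Build {mpoly K[d]} (multipoly K n d) (emb k)
    (emb_monoid_morphism k).

Lemma emb_var k a : emb k 'X_a = mvar K k a.
Proof. by rewrite emb.unlock comp_mpolyXU -tnth_nth tnth_mktuple. Qed.

Lemma multi_perm_emb (s : 'S_n) k P : multi_perm s (emb k P) = emb (s k) P.
Proof.
elim/mpolyind: P => [|a m q _ _ IH]; first by rewrite !linear0.
rewrite !(linearD, linearZ) /= IH mpolyXE_id !rmorph_prod; congr (_ *: _ + _).
apply: eq_bigr => i _.
by rewrite !rmorphXn /= !emb_var multi_perm_var.
Qed.

Lemma meval0_emb k P : (emb k P).@[fun=> 0] = P.@[fun=> 0].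
Proof.
rewrite emb.unlock comp_mpoly_meval; apply: meval_eq => a.
by rewrite tnth_mktuple mevalXU.
Qed.

(** The exponents of the [k]-th multivariable in a monomial. *)
Definition mpart k (m : 'X_{1..#|{: 'I_n * 'I_d}|}) : 'X_{1..d} :=
  [multinom m (enum_rank (k, a)) | a < d].

Lemma mpolyX_parts (m : 'X_{1..#|{: 'I_n * 'I_d}|}) :
  'X_[m] = \prod_(k < n) emb k 'X_[mpart k m] :> multipoly K n d.
Proof.
rewrite mpolyXE_id (reindex (@enum_rank _)) /=; last exact/onW_bij/enum_rank_bij.
under [RHS]eq_bigr => k _ do rewrite mpolyXE_id rmorph_prod /=.
rewrite pair_big /=; apply: eq_bigr => -[k a] _ /=.
by rewrite rmorphXn /= emb_var mnmE.
Qed.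
End Embedding.

Notation tensor_poly K r n d := {ffun word r n -> multipoly K n d}.

Section PolyTensors.
Variables (K : numFieldType) (r n d : nat).
Implicit Types (x y : 'M[K]_r.+1) (P Q : {mpoly K[d]}) (w : word r n).
Implicit Types (F G : tensor_poly K r n d) (s : 'S_n).

(** The action of [x (x) P] on [V^{(x) n} (x) K[x_1, .., x_n]], for [x] in
    gl_{r+1}: it acts by [x] on a tensor factor and multiplies by [P] in the
    corresponding multivariable. *)
Definition poly_act x P F : tensor_poly K r n d :=
  [ffun w : word r n =>
    \sum_(k < n) \sum_(j < r.+1) x (w k) j *: (emb k P * F (upd w k j))].

(** The simultaneous permutation of the factors and of the multivariables. *)
Definition poly_perm s F : tensor_poly K r n d :=
  [ffun w : word r n => multi_perm s (F [ffun i => w (s i)])].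

Lemma poly_act_linear x P : linear (poly_act x P).
Proof.
move=> a F G; apply/ffunP => w; rewrite !ffunE scaler_sumr -big_split /=.
apply: eq_bigr => k _; rewrite scaler_sumr -big_split /=.
apply: eq_bigr => j _.
by rewrite !ffunE mulrDr scalerDr -scalerAr !scalerA mulrC.
Qed.

Lemma poly_act_linearm x F : linear (fun P => poly_act x P F).
Proof.
move=> a P Q; apply/ffunP => w; rewrite !ffunE scaler_sumr -big_split /=.
apply: eq_bigr => k _; rewrite scaler_sumr -big_split /=.
apply: eq_bigr => j _.
by rewrite linearP mulrDl scalerDr -scalerAl !scalerA mulrC.
Qed.

Lemma poly_act_linearl P F : linear (fun x => poly_act x P F).
Proof.
move=> a x y; apply/ffunP => w; rewrite !ffunE scaler_sumr -big_split /=.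
apply: eq_bigr => k _; rewrite scaler_sumr -big_split /=.
by apply: eq_bigr => j _; rewrite !mxE scalerDl scalerA.
Qed.

Lemma poly_perm_linear s : linear (poly_perm s).
Proof. by move=> a F G; apply/ffunP => w; rewrite !ffunE linearP. Qed.

(** A slot [(i, P)] stands for [e_i (x) P]; [elem i j P] acts on slots as
    [E_ij (x) P]. *)
Notation slot := ('I_r.+1 * {mpoly K[d]})%type.

Definition elem (i j : 'I_r.+1) P (c : slot) : slot :=
  (i, (j == c.1)%:R *: (P * c.2)).

(** The decomposable tensor with the given slots. *)
Definition pure (b : 'I_n -> slot) : tensor_poly K r n d :=
  [ffun w : word r n => \prod_(k < n) ((w k == (b k).1)%:R *: emb k (b k).2)].

Lemma poly_act_pure i j P (b : 'I_n -> slot) :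
  poly_act (delta_mx i j) P (pure b) =
  \sum_(k < n) pure (fun l => if l == k then elem i j P (b k) else b l).
Proof.
apply/ffunP => w; rewrite sum_ffunE ffunE; apply: eq_bigr => k _.
rewrite ffunE (bigD1 j) //= big1 ?addr0 => [|l /negPf lj]; last first.
  by rewrite mxE lj andbF scale0r.
rewrite !ffunE (bigD1 k) //= [RHS](bigD1 k) //= !ffunE !eqxx /= mxE eqxx andbT.
rewrite mulrA scalerAl; congr (_ * _).
  by rewrite linearZ /= rmorphM /= -scalerAr !scalerA.
by apply: eq_bigr => l /negPf lk; rewrite ffunE lk.
Qed.

Lemma poly_perm_pure s (b : 'I_n -> slot) :
  poly_perm s (pure b) = pure (fun k => b (s^-1%g k)).
Proof.
apply/ffunP => w; rewrite !ffunE rmorph_prod [RHS](reindex_inj (@perm_inj _ s)).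
by apply: eq_bigr => k _; rewrite /= linearZ /= multi_perm_emb ffunE permK.
Qed.

Lemma pure0 (b : 'I_n -> slot) k : (b k).2 = 0 -> pure b = 0.
Proof.
move=> b0; apply/ffunP => w; rewrite !ffunE (bigD1 k) //= b0.
by rewrite raddf0 scaler0 mul0r.
Qed.

Lemma tensor_poly_decomp F :
  F = \sum_(w : word r n) \sum_(m <- msupp (F w))
        (F w)@_m *: pure (fun k => (w k, 'X_[mpart k m])).
Proof.
apply/ffunP => w; rewrite sum_ffunE (bigD1 w) //= [X in _ + X]big1 ?addr0 => [|u uw].
  rewrite {1}[F w]mpolyE sum_ffunE; apply: eq_bigr => m _.
  rewrite !ffunE mpolyX_parts; congr (_ *: _); apply: eq_bigr => k _.
  by rewrite eqxx scale1r.
rewrite sum_ffunE big1 // => m _; rewrite !ffunE.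
have [k wu] : exists k, w k != u k.
  apply/existsP; rewrite -negb_forall; apply: contra uw => /forallP uw.
  by apply/eqP/ffunP => k; rewrite (eqP (uw k)).
by rewrite (bigD1 k) //= (negPf wu) scale0r mul0r scaler0.
Qed.

(** The symmetrization of the decomposable tensor whose slots are listed in
    [b]; it is used for lists of length [n] only. *)
Definition symz (b : seq slot) : tensor_poly K r n d :=
  \sum_(s : 'S_n) pure (fun k => nth (ord0, 1) b (s k)).

Lemma symz_perm (b c : seq slot) : size b = n -> perm_eq b c -> symz b = symz c.
Proof.
move=> /eqP bn bc.
have cn : size c == n by rewrite -(perm_size bc).
have /tuple_permP[p bE] : perm_eq (Tuple bn) (Tuple cn) by [].
rewrite /symz [RHS](reindex_inj (@mulIg _ p)); apply: eq_bigr => s _.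
congr pure; apply/funext => k.
rewrite [in LHS](_ : b = [tuple tnth (Tuple cn) (p i) | i < n]) //.
by rewrite -tnth_nth tnth_mktuple permM (tnth_nth (ord0, 1)).
Qed.

Lemma list_of_slots (b : seq slot) : size b = n ->
  b = [seq nth (ord0, 1) b (k : 'I_n) | k : 'I_n <- enum 'I_n].
Proof.
move=> bn; apply: (@eq_from_nth _ (ord0, 1)); first by rewrite size_map size_enum_ord.
move=> k; rewrite bn => kn.
by rewrite (nth_map (Ordinal kn)) ?size_enum_ord // nth_enum_ord.
Qed.

Lemma poly_act_symz i j P (b : seq slot) : size b = n ->
  poly_act (delta_mx i j) P (symz b) =
  \sum_(c <- slotwise (elem i j P) b) symz c.
Proof.
move=> bn; rewrite {2}(list_of_slots bn) slotwise_map ?enum_uniq //.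
rewrite big_map big_enum /= /symz (lin_sum (@poly_act_linear _ _)).
under [LHS]eq_bigr do rewrite poly_act_pure.
rewrite [RHS]exchange_big /=; apply: eq_bigr => s _.
rewrite [RHS](reindex_inj (@perm_inj _ s)) /=; apply: eq_bigr => k _.
congr pure; apply/funext => l.
rewrite (nth_map (s l)) ?size_enum_ord // nth_ord_enum.
by rewrite (inj_eq perm_inj).
Qed.

(** The [Sigma_n]-invariant tensors are generated from the highest weight
    vector [e_0 (x) .. (x) e_0] by the operators [E_i0 (x) P]. *)
Lemma invariant_tensor_gen (S : tensor_poly K r n d -> Prop) :
  S 0 -> (forall a F G, S F -> S G -> S (a *: F + G)) ->
  (forall i P F, S F -> S (poly_act (delta_mx i ord0) P F)) ->
  S (pure (fun=> (ord0, 1))) ->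
  forall F, (forall s, poly_perm s F = F) -> S F.
Proof.
move=> S0 Slin Sact S1 F Finv.
have SZ a G : S G -> S (a *: G) by move=> ?; rewrite -[_ *: _]addr0; apply: Slin.
have SD G H : S G -> S H -> S (G + H) by rewrite -{2}[G]scale1r; apply: Slin.
have Ssum I (l : seq I) (H : I -> tensor_poly K r n d) :
    (forall i, S (H i)) -> S (\sum_(i <- l) H i).
  by move=> SH; apply: big_ind.
have Ssymz (b : seq slot) : size b = n -> S (symz b).
  apply: (@polarization K _ _ symz S n (ord0, 1)
    (fun b => elem b.1 ord0 b.2) (fun b => poly_act (delta_mx b.1 ord0) b.2)) => //.
  - by move=> [i P] G SG; apply: Sact.
  - by move=> [i P]; rewrite /elem /= scale1r mulr1.
  - move=> c1 x c2 hn; apply: symz_perm; first by rewrite size_cat /= addnS.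
    by rewrite perm_catC /= perm_cons perm_catC.
  - by move=> [i P] c cn; rewrite poly_act_symz.
  rewrite /symz (eq_bigr (fun=> pure (fun=> (ord0, 1)))) => [|s _].
    by rewrite sumr_const -scaler_nat; apply: SZ.
  by congr pure; apply/funext => k; rewrite nth_nseq if_same.
have -> : F = (n`!)%:R^-1 *: \sum_(s : 'S_n) poly_perm s F.
  rewrite (eq_bigr (fun=> F)) // sumr_const card_Sn -[in RHS]scaler_nat.
  by rewrite scalerK // pnatr_eq0 -lt0n fact_gt0.
apply: (SZ); rewrite [F]tensor_poly_decomp.
under eq_bigr => s _ do rewrite (lin_sum (@poly_perm_linear s)).
rewrite exchange_big; apply: (Ssum) => w /=.
under eq_bigr => s _ do rewrite (lin_sum (@poly_perm_linear s)).
rewrite exchange_big; apply: (Ssum) => m /=.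
under eq_bigr => s _ do rewrite (linZ (@poly_perm_linear s)) poly_perm_pure.
rewrite -scaler_sumr; apply: SZ.
pose b := [seq (w k, 'X_[mpart k m] : {mpoly K[d]}) | k <- enum 'I_n].
suff -> : \sum_(s : 'S_n) pure (fun k => (w (s^-1%g k), 'X_[mpart (s^-1%g k) m]))
    = symz b by apply: Ssymz; rewrite size_map size_enum_ord.
rewrite (reindex_inj invg_inj) /=; apply: eq_bigr => s _.
congr pure; apply/funext => k.
by rewrite invgK (nth_map (s k)) ?size_enum_ord // nth_ord_enum.
Qed.

End PolyTensors.

(** * The Lie action on tensors *)

Section LieAction.
Variables (K : numFieldType) (r n d : nat).
Implicit Types (x y : 'M[K]_r.+1) (P Q : {mpoly K[d]}) (w : word r n).
Implicit Types (F G : tensor_poly K r n d) (s : 'S_n) (k l : 'I_n).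

(** The summand of [poly_act] that acts on the [k]-th factor. *)
Definition site_act k x P F : tensor_poly K r n d :=
  [ffun w : word r n => \sum_(j < r.+1) x (w k) j *: (emb k P * F (upd w k j))].

Lemma poly_act_sites x P F : poly_act x P F = \sum_k site_act k x P F.
Proof.
by apply/ffunP => w; rewrite sum_ffunE ffunE; apply: eq_bigr => k _; rewrite ffunE.
Qed.

Lemma site_act_linear k x P : linear (site_act k x P).
Proof.
move=> a F G; apply/ffunP => w; rewrite !ffunE scaler_sumr -big_split /=.
apply: eq_bigr => j _.
by rewrite !ffunE mulrDr scalerDr -scalerAr !scalerA mulrC.
Qed.

Lemma site_act_comp k x y P Q F :
  site_act k x P (site_act k y Q F) = site_act k (x *m y) (P * Q) F.
Proof.
apply/ffunP => w; rewrite !ffunE.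
transitivity (\sum_(j < r.+1) \sum_(i < r.+1)
    (x (w k) j * y j i) *: (emb k (P * Q) * F (upd w k i))).
  apply: eq_bigr => j _; rewrite ffunE mulr_sumr scaler_sumr.
  apply: eq_bigr => i _; rewrite ffunE eqxx updK rmorphM /=.
  by rewrite -scalerAr scalerA mulrA.
rewrite exchange_big; apply: eq_bigr => i _; rewrite mxE -scaler_suml.
by [].
Qed.

Lemma site_act_comm k l x y P Q F : k != l ->
  site_act k x P (site_act l y Q F) = site_act l y Q (site_act k x P F).
Proof.
move=> kl; apply/ffunP => w; rewrite !ffunE.
transitivity (\sum_(j < r.+1) \sum_(i < r.+1) (x (w k) j * y (w l) i) *:
    (emb k P * emb l Q * F (upd (upd w k j) l i))).
  apply: eq_bigr => j _; rewrite ffunE mulr_sumr scaler_sumr.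
  apply: eq_bigr => i _; rewrite ffunE eq_sym (negPf kl).
  by rewrite -scalerAr scalerA mulrA.
rewrite exchange_big; apply: eq_bigr => i _ /=; rewrite [in RHS]ffunE.
rewrite [emb l Q * _ in RHS]mulr_sumr scaler_sumr.
apply: eq_bigr => j _; rewrite ffunE (negPf kl) updC //.
by rewrite -scalerAr scalerA [y _ _ * _]mulrC [in RHS]mulrA [emb l Q * _]mulrC.
Qed.

Lemma poly_act_bracket x y P Q F :
  poly_act x P (poly_act y Q F) - poly_act y Q (poly_act x P F)
  = poly_act (x *m y - y *m x) (P * Q) F.
Proof.
have E z t R S : poly_act z R (poly_act t S F) =
    \sum_k \sum_l site_act k z R (site_act l t S F).
  rewrite !poly_act_sites; apply: eq_bigr => k _.
  by rewrite -(lin_sum (@site_act_linear _ _ _)).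
rewrite E E [X in _ - X]exchange_big /= -sumrB.
rewrite (linB (@poly_act_linearl K r n d (P * Q) F)) !poly_act_sites -sumrB.
apply: eq_bigr => k _; rewrite -sumrB (bigD1 k) //= [X in _ + X]big1 ?addr0.
  by rewrite !site_act_comp (mulrC Q).
by move=> l lk; rewrite site_act_comm 1?eq_sym // subrr.
Qed.

Lemma poly_perm_act s x P F :
  poly_perm s (poly_act x P F) = poly_act x P (poly_perm s F).
Proof.
apply/ffunP => w; rewrite ![in LHS]ffunE [RHS]ffunE.
rewrite linear_sum /= [RHS](reindex_inj (@perm_inj _ s)).
apply: eq_bigr => k _; rewrite linear_sum; apply: eq_bigr => j _.
rewrite linearZ /= rmorphM /= multi_perm_emb !ffunE; congr (_ *: (_ * multi_perm s (F _))).
by apply/ffunP => i; rewrite !ffunE (inj_eq perm_inj).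
Qed.

Lemma poly_perm_mul s t F :
  poly_perm s (poly_perm t F) = poly_perm (t * s)%g F.
Proof.
apply/ffunP => w; rewrite !ffunE multi_perm_mul; congr (multi_perm _ (F _)).
by apply/ffunP => i; rewrite !ffunE permM.
Qed.

Lemma poly_act_scalar P F w :
  poly_act 1%:M P F w = (\sum_k emb k P) * F w.
Proof.
rewrite ffunE mulr_suml; apply: eq_bigr => k _.
rewrite (bigD1 (w k)) //= mxE eqxx scale1r big1 ?addr0 => [|j jk]; last first.
  by rewrite mxE eq_sym (negPf jk) scale0r.
congr (_ * F _); apply/ffunP => i; rewrite ffunE.
by case: eqP => // ->.
Qed.

Lemma power_sum_invariant P : multi_invariant (\sum_(k < n) emb k P).
Proof.
move=> s; rewrite linear_sum [RHS](reindex_inj (@perm_inj _ s)).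
by apply: eq_bigr => k _; rewrite /= multi_perm_emb.
Qed.

Lemma coinv_ideal_mul (p q : multipoly K n d) :
  p \in @coinv_ideal K n d -> q * p \in @coinv_ideal K n d.
Proof.
rewrite !unfold_in => /asboolP[k [f [g [hf ->]]]]; apply/asboolP.
exists k, f, (fun i => q * g i); split=> //.
by rewrite mulr_sumr; apply: eq_bigr => i _; rewrite mulrCA.
Qed.

Lemma coinv_ideal_inv (p q : multipoly K n d) :
  multi_invariant p -> p.@[fun=> 0] = 0 -> p * q \in @coinv_ideal K n d.
Proof.
move=> pinv p0; rewrite unfold_in; apply/asboolP.
by exists 1%N, (fun=> p), (fun=> q); split=> //; rewrite big_ord1.
Qed.

Lemma coinv_power_sum P (p : multipoly K n d) :
  coinv_pi ((\sum_(k < n) emb k P) * p) = (n%:R * P.@[fun=> 0]) *: coinv_pi p.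
Proof.
rewrite -linearZ; apply/coinv_piP.
rewrite -mul_mpolyC -mulrBl; apply: coinv_ideal_inv => [s|].
  by rewrite linearB /= power_sum_invariant /multi_perm comp_mpolyC.
rewrite mevalB mevalC raddf_sum /= (eq_bigr (fun=> P.@[fun=> 0])) => [|k _].
  by rewrite sumr_const card_ord mulr_natl subrr.
exact: meval0_emb.
Qed.

(** * Passing to the coinvariants *)

(** Reduction of the coefficients modulo the coinvariant ideal. *)
Definition coinv_tensor F : tensor_coinv K r n d := [ffun w => coinv_pi (F w)].

(** A section of [coinv_tensor], which is not linear. *)
Definition lift_tensor (F : tensor_coinv K r n d) : tensor_poly K r n d :=
  [ffun w => coinv_repr (F w)].

Lemma lift_tensorK : cancel lift_tensor coinv_tensor.
Proof. by move=> F; apply/ffunP => w; rewrite !ffunE coinv_reprK. Qed.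

Lemma coinv_tensor_linear : linear coinv_tensor.
Proof. by move=> a F G; apply/ffunP => w; rewrite !ffunE linearP. Qed.

(** [poly_act] modulo the coinvariant ideal. *)
Definition coinv_act x P (F : tensor_coinv K r n d) : tensor_coinv K r n d :=
  coinv_tensor (poly_act x P (lift_tensor F)).

Lemma coinv_tensor_act x P F :
  coinv_act x P (coinv_tensor F) = coinv_tensor (poly_act x P F).
Proof.
apply/ffunP => w; rewrite ![in LHS]ffunE ![in RHS]ffunE; apply/coinv_piP.
rewrite -sumrB rpred_sum // => k _; rewrite -sumrB rpred_sum // => j _.
rewrite -scalerBr rpredZ // -mulrBr coinv_ideal_mul //.
by apply/coinv_piP; rewrite !ffunE coinv_reprK.
Qed.

Lemma tensor_perm_coinv s F :
  tensor_perm s (coinv_tensor F) = coinv_tensor (poly_perm s F).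
Proof. by apply/ffunP => w; rewrite !ffunE coinv_perm_pi. Qed.

(** The elements [1 (x) P] act by scalars. *)
Lemma coinv_act_scalar P (F : tensor_coinv K r n d) :
  coinv_act 1%:M P F = (n%:R * P.@[fun=> 0]) *: F.
Proof.
rewrite -[F]lift_tensorK coinv_tensor_act; apply/ffunP => w.
rewrite ffunE poly_act_scalar coinv_power_sum.
by rewrite [RHS]ffunE [in RHS]ffunE.
Qed.

Lemma coinv_act_linear x P : linear (coinv_act x P).
Proof.
move=> a F G; rewrite -[F]lift_tensorK -[G]lift_tensorK -coinv_tensor_linear.
by rewrite !coinv_tensor_act poly_act_linear coinv_tensor_linear.
Qed.

Lemma coinv_act_linearl P (F : tensor_coinv K r n d) : linear (fun x => coinv_act x P F).
Proof. by move=> a x y; rewrite /coinv_act poly_act_linearl coinv_tensor_linear. Qed.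

Lemma coinv_act_linearm x (F : tensor_coinv K r n d) : linear (fun P => coinv_act x P F).
Proof. by move=> a P Q; rewrite /coinv_act poly_act_linearm coinv_tensor_linear. Qed.

Lemma coinv_act_bracket x y P Q (F : tensor_coinv K r n d) :
  coinv_act x P (coinv_act y Q F) - coinv_act y Q (coinv_act x P F)
  = coinv_act (x *m y - y *m x) (P * Q) F.
Proof.
rewrite -[F]lift_tensorK !coinv_tensor_act.
by rewrite -(linB coinv_tensor_linear) poly_act_bracket.
Qed.

Lemma coinv_act1 (x : sl K r) (F : tensor_coinv K r n d) :
  coinv_act x 1 F = tensor_act x F.
Proof.
rewrite -[F]lift_tensorK coinv_tensor_act; apply/ffunP => w.
rewrite !ffunE linear_sum; apply: eq_bigr => k _.
rewrite linear_sum; apply: eq_bigr => j _.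
by rewrite rmorph1 mul1r linearZ !ffunE.
Qed.

Lemma coinv_act_invariant x P (F : tensor_coinv K r n d) :
  F \in @perm_invariant K r n d -> coinv_act x P F \in @perm_invariant K r n d.
Proof.
rewrite !unfold_in => /forallP Finv; apply/forallP => s.
rewrite -[F]lift_tensorK coinv_tensor_act tensor_perm_coinv poly_perm_act.
by rewrite -coinv_tensor_act -tensor_perm_coinv lift_tensorK (eqP (Finv s)).
Qed.

Lemma inv_tensorP (F : invariants K r n d) :
  (F : tensor_coinv K r n d) \in @perm_invariant K r n d.
Proof. by case: F. Qed.

(** The action of [x (x) P] on the invariants, for [x] in gl_{r+1}. *)
Definition inv_cur_act x P (F : invariants K r n d) : invariants K r n d :=
  Invariants (coinv_act_invariant x P (inv_tensorP F)).

Fact hw_invariant :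
  coinv_tensor (pure (fun=> (ord0, 1))) \in @perm_invariant K r n d.
Proof.
rewrite unfold_in; apply/forallP => s.
by rewrite tensor_perm_coinv poly_perm_pure.
Qed.

(** The highest weight vector [e_0 (x) .. (x) e_0 (x) 1]. *)
Definition hw : invariants K r n d := Invariants hw_invariant.

(** By averaging, an invariant tensor with coefficients in the coinvariants is
    the image of an invariant tensor with polynomial coefficients. *)
Lemma invariants_generated (S : invariants K r n d -> Prop) :
  S hw -> S 0 -> (forall a H H', S H -> S H' -> S (a *: H + H')) ->
  (forall x P H, S H -> S (inv_cur_act x P H)) ->
  forall H, S H.
Proof.
move=> Shw S0 Slin Sact F.
pose S' (G : tensor_poly K r n d) := exists2 H, S H & inv_tensor H = coinv_tensor G.
pose G := (n`!)%:R^-1 *: \sum_(s : 'S_n) poly_perm s (lift_tensor F).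
have [||||s|H SH HE] := @invariant_tensor_gen K r n d S' _ _ _ _ G.
- by exists 0; rewrite // (lin0 coinv_tensor_linear).
- move=> a F' G' [H SH HE] [H' SH' HE']; exists (a *: H + H'); first exact: Slin.
  by rewrite coinv_tensor_linear -HE -HE'.
- move=> i P F' [H SH HE]; exists (inv_cur_act (delta_mx i ord0) P H).
    exact: Sact.
  by rewrite /= HE coinv_tensor_act.
- by exists hw.
- rewrite /G (linZ (@poly_perm_linear _ _ _ _ s)) (lin_sum (@poly_perm_linear _ _ _ _ s)).
  congr (_ *: _); rewrite [RHS](reindex_inj (@mulIg _ s)).
  by apply: eq_bigr => t _; rewrite poly_perm_mul.
suff -> : F = H by [].
apply: val_inj; rewrite /= HE /G (linZ coinv_tensor_linear) (lin_sum coinv_tensor_linear).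
rewrite (eq_bigr (fun=> val F)) => [|s _].
  rewrite sumr_const card_Sn -[in RHS]scaler_nat.
  by rewrite scalerK // pnatr_eq0 -lt0n fact_gt0.
rewrite -tensor_perm_coinv lift_tensorK.
by have /forallP/(_ s)/eqP := inv_tensorP F.
Qed.

End LieAction.

(** * The Cartan subalgebra *)

Section Cartan.
Variables (K : numFieldType) (r : nat).
Implicit Types (x y : 'M[K]_r.+1) (h : sl K r).

Fact traceless_part_subproof x :
  x - (\tr x / r.+1%:R)%:M \in @traceless K r.
Proof.
rewrite unfold_in linearB /= mxtrace_scalar -[_ *+ _]mulr_natr divfK ?subrr //.
by rewrite pnatr_eq0.
Qed.

(** The projection of gl_{r+1} onto sl_{r+1} along the scalar matrices. *)
Definition traceless_part x : sl K r := Sl (traceless_part_subproof x).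

Lemma traceless_part_linear : linear traceless_part.
Proof.
move=> a x y; apply: val_inj; rewrite /= linearP /= mulrDl -mulrA.
by rewrite raddfD /= -scale_scalar_mx scalerBr opprD addrACA.
Qed.

Lemma sl_trace h : \tr h = 0.
Proof. by case: h => x /=; rewrite unfold_in => /eqP. Qed.

Lemma traceless_part_sl h : traceless_part h = h.
Proof. by apply: val_inj; rewrite /= sl_trace mul0r raddf0 subr0. Qed.

Lemma traceless_part_bracket x y :
  sl_bracket (traceless_part x) (traceless_part y)
  = traceless_part (x *m y - y *m x).
Proof.
have t0 : \tr (x *m y - y *m x) = 0 by rewrite linearB /= mxtrace_mulC subrr.
apply: val_inj => /=; rewrite t0 mul0r raddf0 subr0.
set a := _ / _; set b := _ / _.
rewrite !mulmxBl !mulmxBr !mul_mx_scalar !mul_scalar_mx.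
rewrite !scale_scalar_mx (mulrC b).
set u := a *: y; set v := b *: x; set w := _%:M.
have -> : x *m y - v - (u - w) = x *m y - (v + (u - w)) by rewrite [in RHS]opprD addrA.
have -> : y *m x - u - (v - w) = y *m x - (v + (u - w)).
  by rewrite (addrCA v) [in RHS]opprD addrA.
by move: (v + _) => t; rewrite opprB addrA subrK.
Qed.

Lemma mxtrace_delta (i j : 'I_r.+1) : \tr (delta_mx i j : 'M[K]_r.+1) = (i == j)%:R.
Proof.
rewrite /mxtrace (bigD1 i) //= mxE eqxx big1 ?addr0 // => k /negPf ki.
by rewrite mxE ki.
Qed.

(** Abel summation: the last partial sum of the diagonal of [h] is its trace. *)
Lemma cartan_coord h (c : 'I_r.+1) :
  \sum_(i < r) fund_weight i h * coroot K i c c = h c c.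
Proof.
pose H (m : nat) : K := \sum_(j < r.+1 | (j <= m)%N) h j j.
have Hr : H r = 0.
  have -> : H r = \tr h by apply: eq_bigl => j; rewrite -ltnS ltn_ord.
  exact: sl_trace.
have E1 : \sum_(i < r) H i * (lift ord_max i == c)%:R = H c.
  transitivity (\sum_(i < r.+1) H i * (i == c)%:R).
    rewrite big_ord_recr /= Hr mul0r addr0; apply: eq_bigr => i _.
    by congr (_ * (_ == c)%:R); apply: val_inj; apply: lift_max.
  rewrite (bigD1 c) //= eqxx mulr1 big1 ?addr0 // => i /negPf ->.
  by rewrite mulr0.
have E0 : \sum_(i < r) H i * (lift ord0 i == c)%:R = H c - h c c.
  rewrite {2}/H [in RHS](bigD1 c) //= [RHS]addrC addKr /H.
  case: (unliftP ord0 c) => [c'|] ->; last first.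
    rewrite !big1 // => [i|i _]; last by rewrite mulr0.
    by rewrite leqn0 -val_eqE /= => /andP[->].
  rewrite (bigD1 c') //= eqxx mulr1 [X in _ + X]big1 ?addr0 => [|i ic].
    apply: eq_bigl => i; rewrite andbC -(inj_eq val_inj) -ltn_neqAle.
    by rewrite /= /bump leq0n add1n ltnS.
  by rewrite (inj_eq lift_inj) (negPf ic) mulr0.
rewrite -[RHS](subKr (H c)) -E0 -E1 -sumrB.
apply: eq_bigr => i _; rewrite !mxE !andbb -mulrBr; congr (_ * (_%:R - _%:R)).
all: by rewrite eq_sym.
Qed.

Lemma delta_offdiag (i k l : 'I_r.+1) : k != l :> nat ->
  (delta_mx i i : 'M[K]_r.+1) k l = 0.
Proof.
move=> kl; rewrite mxE; case: andP => // -[/eqP ki /eqP li].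
by rewrite ki li eqxx in kl.
Qed.

Lemma cartan_decomp h : in_cartan h ->
  h = \sum_(i < r) fund_weight i h *: coroot K i.
Proof.
move=> /is_diag_mxP hd; apply: val_inj; rewrite linear_sum.
apply/matrixP => i j; rewrite summxE; have [<-|ij] := eqVneq i j.
  by rewrite -cartan_coord; apply: eq_bigr => k _; rewrite !mxE.
rewrite hd // big1 // => k _.
by rewrite [LHS]mxE [X in _ * X]mxE [X in _ + X]mxE !delta_offdiag // subrr mulr0.
Qed.

Lemma weight_val_coroot (m : 'rV[int]_r) i :
  weight_val m (coroot K i) = (m 0 i)%:~R.
Proof.
rewrite /weight_val (bigD1 i) //= fund_weight_coroot eqxx mulr1 big1 ?addr0 //.
by move=> j /negPf ji; rewrite fund_weight_coroot ji mulr0.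
Qed.

Lemma coroot_cartan (i : 'I_r) : in_cartan (coroot K i).
Proof.
apply/is_diag_mxP => j l jl.
by rewrite [LHS]mxE [X in _ + X]mxE !delta_offdiag // subrr.
Qed.

Lemma coroot00 (i : 'I_r) : coroot K i ord0 ord0 = (i == 0%N :> nat)%:R.
Proof.
rewrite !mxE !andbb (negPf (neq_lift ord0 i)) subr0.
by rewrite -(inj_eq val_inj) [val (lift _ _)]lift_max eq_sym.
Qed.

End Cartan.

(** * The invariants satisfy the defining relations *)

Section InvariantsModule.
Variables (K : numFieldType) (r n d : nat).
Implicit Types (P Q : {mpoly K[d]}) (h x y : sl K r) (w : word r n).
Implicit Types (F G : invariants K r n d) (m : 'rV[int]_r).

(** The action of sl_{r+1} (x) A on the invariants. *)
Definition inv_rho x P F : invariants K r n d := inv_cur_act x P F.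

Lemma inv_rho1 x : inv_rho x 1 =1 inv_act x.
Proof. by move=> F; apply: val_inj; apply: coinv_act1. Qed.

Lemma inv_rho_current : current_action inv_rho.
Proof.
split=> [P F a x y|x F a P Q|x P a F G|x y P Q F]; apply: val_inj => /=.
- exact: coinv_act_linearl.
- exact: coinv_act_linearm.
- exact: coinv_act_linear.
- by rewrite -coinv_act_bracket.
Qed.

(** gl_{r+1} (x) A and sl_{r+1} (x) A differ on the invariants by scalars
    only, so they generate the same submodules. *)
Lemma inv_cur_act_split (x : 'M[K]_r.+1) P F :
  inv_cur_act x P F = inv_rho (traceless_part x) P F
    + (\tr x / r.+1%:R * (n%:R * P.@[fun=> 0])) *: F.
Proof.
apply: val_inj => /=; rewrite -scalerA -coinv_act_scalar.
rewrite -(linZ (coinv_act_linearl P (inv_tensor F))).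
rewrite -(linD (coinv_act_linearl P (inv_tensor F))).
by rewrite scale_scalar_mx mulr1 subrK.
Qed.

Lemma inv_rho_generated : generated_by inv_rho (hw K r n d).
Proof.
move=> S Shw S0 Slin Sact; apply: invariants_generated => // x P F SF.
by rewrite inv_cur_act_split addrC; apply: Slin => //; apply: Sact.
Qed.

(** Only the first column of [x] sees the highest weight vector. *)
Lemma coinv_act_hw (x : 'M[K]_r.+1) P :
  coinv_act x P (hw K r n d) =
  \sum_i x i ord0 *: coinv_act (delta_mx i ord0) P (hw K r n d).
Proof.
rewrite /= {1}[x]matrix_sum_delta (lin_sum (coinv_act_linearl P _)).
apply: eq_bigr => i _; rewrite (lin_sum (coinv_act_linearl P _)).
rewrite (bigD1 ord0) //= (linZ (coinv_act_linearl P _)) big1 ?addr0 // => j j0.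
rewrite (linZ (coinv_act_linearl P _)) coinv_tensor_act poly_act_pure.
rewrite big1 ?(lin0 (@coinv_tensor_linear _ _ _ _)) ?scaler0 // => k _.
by apply: (@pure0 _ _ _ _ _ k); rewrite eqxx /= (negPf j0) scale0r.
Qed.

Lemma inv_rho_nilp x P : in_nilp x -> inv_rho x P (hw K r n d) = 0.
Proof.
move=> xn; apply: val_inj; rewrite [LHS]coinv_act_hw big1 // => i _.
by rewrite xn // scale0r.
Qed.

Lemma inv_rho_cartan h P : in_cartan h ->
  inv_rho h P (hw K r n d) = (h ord0 ord0 * (n%:R * P.@[fun=> 0])) *: hw K r n d.
Proof.
move=> /is_diag_mxP hd; apply: val_inj; rewrite [LHS]coinv_act_hw.
have diag (y : 'M[K]_r.+1) : (forall i : 'I_r.+1, i != ord0 -> y i ord0 = 0) ->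
    \sum_i y i ord0 *: coinv_act (delta_mx i ord0) P (hw K r n d)
    = y ord0 ord0 *: coinv_act (delta_mx ord0 ord0) P (hw K r n d).
  by move=> yd; rewrite (bigD1 ord0) //= big1 ?addr0 // => i /yd ->; rewrite scale0r.
rewrite diag => [|i i0]; last by rewrite hd.
rewrite /= -scalerA -coinv_act_scalar (coinv_act_hw 1%:M) diag => [|i i0].
  by rewrite mxE eqxx scale1r.
by rewrite mxE (negPf i0).
Qed.

(** The weight of [e_w]: its [i]-th coordinate is the eigenvalue of the simple
    coroot [E_ii - E_{i+1,i+1}]. *)
Definition word_weight w : 'rV[int]_r :=
  \row_i \sum_(k < n) ((w k == lift ord_max i)%:R - (w k == lift ord0 i)%:R).

Lemma word_weightE w h : \sum_k h (w k) (w k) = weight_val (word_weight w) h.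
Proof.
under eq_bigr do rewrite -cartan_coord.
rewrite exchange_big; apply: eq_bigr => i _; rewrite mxE -mulr_sumr mulrC.
congr (_ * _); rewrite raddf_sum; apply: eq_bigr => k _.
by rewrite !mxE !andbb raddfB /= !mulrz_nat.
Qed.

Lemma tensor_act_cartan h (F : tensor_coinv K r n d) w : in_cartan h ->
  tensor_act h F w = weight_val (word_weight w) h *: F w.
Proof.
move=> /is_diag_mxP hd; rewrite ffunE -word_weightE scaler_suml.
apply: eq_bigr => k _; rewrite (bigD1 (w k)) //= big1 ?addr0 => [|j jk].
  by congr (_ *: F _); apply/ffunP => i; rewrite ffunE; case: eqP => // ->.
by rewrite hd ?scale0r // eq_sym.
Qed.

Lemma weight_space_support m F w :
  in_weight_space (fun x => inv_rho x 1) m F -> word_weight w != m ->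
  inv_tensor F w = 0.
Proof.
move=> Fm wm; apply/eqP; apply: contraNT wm => Fw.
apply/eqP/rowP => i.
have := Fm _ (coroot_cartan K i); rewrite inv_rho1 => /(congr1 val)/= /ffunP/(_ w).
rewrite tensor_act_cartan; last exact: coroot_cartan.
rewrite !weight_val_coroot [in RHS]ffunE => /eqP; rewrite -subr_eq0 -scalerBl.
by rewrite scaler_eq0 (negPf Fw) orbF subr_eq0 eqr_int => /eqP.
Qed.

Fact weight_part_subproof m F :
  [ffun w => if word_weight w == m then inv_tensor F w else 0]
    \in @perm_invariant K r n d.
Proof.
rewrite unfold_in; apply/forallP => s; apply/eqP/ffunP => w; rewrite !ffunE.
have -> : word_weight [ffun i => w (s i)] = word_weight w.
  apply/rowP => i; rewrite !mxE [RHS](reindex_inj (@perm_inj _ s)).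
  by apply: eq_bigr => k _; rewrite ffunE.
have /forallP/(_ s)/eqP/ffunP/(_ w) := inv_tensorP F; rewrite ffunE.
by case: ifP => // _ _; rewrite linear0.
Qed.

(** The component of weight [m]: the coefficients at the words of weight [m]. *)
Definition weight_part m F : invariants K r n d :=
  Invariants (weight_part_subproof m F).

Lemma inv_rho_integrable : integrable (fun x => inv_rho x 1).
Proof.
exists (undup [seq word_weight w | w <- enum {: word r n}]).
have wD w : word_weight w \in undup [seq word_weight w | w <- enum {: word r n}].
  by rewrite mem_undup; apply: map_f; rewrite mem_enum.
split; first exact: undup_uniq.
- move=> F; exists (weight_part^~ F); split=> [m _ h hc|].
    rewrite inv_rho1; apply: val_inj; apply/ffunP => w.
    rewrite /= tensor_act_cartan // !ffunE.
    by case: eqP => [->|_]; rewrite ?scaler0.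
  apply: val_inj; rewrite linear_sum; apply/ffunP => w; rewrite sum_ffunE.
  rewrite (bigD1_seq (word_weight w)) ?undup_uniq //= ffunE eqxx big1 ?addr0 //.
  by move=> m; rewrite eq_sym ffunE => /negPf ->.
- move=> u hu u0 m mD; apply: val_inj; apply/ffunP => w.
  rewrite [RHS]ffunE; have [wm|] := eqVneq (word_weight w) m; last first.
    exact/weight_space_support/hu.
  move/(congr1 val): u0; rewrite linear_sum => /ffunP/(_ w).
  rewrite sum_ffunE (bigD1_seq m) ?undup_uniq //= big_seq_cond big1 ?addr0.
    by move=> ->; rewrite ffunE.
  move=> m' /andP[m'D m'm]; apply: weight_space_support (hu m' m'D) _.
  by rewrite wm eq_sym.
Qed.

Lemma inv_rho_weyl : weyl_conditions n inv_rho (hw K r n d).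
Proof.
split.
- exact: inv_rho_current.
- exact: inv_rho_integrable.
- exact: inv_rho_generated.
- exact: inv_rho_nilp.
- move=> i P i0; rewrite inv_rho_cartan; last exact: coroot_cartan.
  by rewrite coroot00 i0 mul1r.
- move=> i P i0; rewrite inv_rho_cartan; last exact: coroot_cartan.
  by rewrite coroot00 gtn_eqF // mul0r scale0r.
Qed.

End InvariantsModule.

(** * Relations in an arbitrary module with the defining properties *)

Section WeylRelations.
Variables (K : numFieldType) (r n d : nat) (W : lmodType K).
Variables (rho : sl K r -> {mpoly K[d]} -> W -> W) (v : W).
Hypothesis rhoW : weyl_conditions n rho v.
Implicit Types (P Q : {mpoly K[d]}) (h : sl K r) (x y : 'M[K]_r.+1) (u : W).
Implicit Types (i j : 'I_r.+1).

Let rho_linl P u : linear (fun h => rho h P u) := cur_act_linl (weyl_action rhoW) P u.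
Let rho_linm h u : linear (fun P => rho h P u) := cur_act_linm (weyl_action rhoW) h u.
Let rho_linr h P : linear (rho h P) := cur_act_linr (weyl_action rhoW) h P.

(** The extension of the action to gl_{r+1} (x) A in which [1 (x) P] acts by
    the scalar [n P(0)], as it does on the invariants. *)
Definition gl_act x P u : W :=
  rho (traceless_part x) P u + (\tr x / r.+1%:R * (n%:R * P.@[fun=> 0])) *: u.

Lemma gl_act_linear x P : linear (gl_act x P).
Proof.
by move=> a u w; rewrite /gl_act rho_linr !scalerDr addrACA !scalerA (mulrC a).
Qed.

Lemma gl_act_linearl P u : linear (fun x => gl_act x P u).
Proof.
move=> a x y; rewrite /gl_act traceless_part_linear rho_linl.
rewrite linearP /= mulrDl mulrDl scalerDl scalerDr addrACA !scalerA.
by rewrite -!mulrA.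
Qed.

Lemma gl_act_linearm x u : linear (fun P => gl_act x P u).
Proof.
move=> a P Q; rewrite /gl_act rho_linm mevalD mevalZ.
rewrite scalerDr addrACA scalerA -scalerDl; congr (_ + _ *: _).
by ring.
Qed.

Lemma gl_act_bracket x y P Q u :
  gl_act x P (gl_act y Q u) - gl_act y Q (gl_act x P u)
  = gl_act (x *m y - y *m x) (P * Q) u.
Proof.
rewrite /gl_act linearB /= (mxtrace_mulC y) subrr !mul0r scale0r addr0.
rewrite -traceless_part_bracket (cur_act_bracket (weyl_action rhoW)).
rewrite !(linD (rho_linr _ _)) !(linZ (rho_linr _ _)) !scalerDr !scalerA.
by rewrite subr_regroup (mulrC _ (\tr x / _ * _)) subrr addr0.
Qed.

Lemma gl_act_sl h P u : gl_act h P u = rho h P u.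
Proof.
by rewrite /gl_act traceless_part_sl sl_trace !mul0r scale0r addr0.
Qed.

Lemma gl_act_scalar P u : gl_act 1%:M P u = (n%:R * P.@[fun=> 0]) *: u.
Proof.
rewrite /gl_act mxtrace1 divff ?pnatr_eq0 // mul1r.
have -> : traceless_part (1%:M : 'M[K]_r.+1) = 0.
  by apply: val_inj; rewrite /= mxtrace1 divff ?pnatr_eq0 // subrr.
by rewrite (lin0 (rho_linl _ _)) add0r.
Qed.

Lemma rho_cartan h P : in_cartan h ->
  rho h P v = (h ord0 ord0 * (n%:R * P.@[fun=> 0])) *: v.
Proof.
move=> hc; rewrite {1}(cartan_decomp hc) (lin_sum (rho_linl _ _)).
rewrite -cartan_coord mulr_suml scaler_suml; apply: eq_bigr => i _.
rewrite (linZ (rho_linl _ _)) coroot00 -mulrA -scalerA; congr (_ *: _).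
have [i0|i0] := eqVneq (i : nat) 0%N.
  by rewrite mul1r (weyl_first rhoW).
by rewrite mul0r scale0r (weyl_other rhoW) // lt0n.
Qed.

Lemma gl_act_diag j P :
  gl_act (delta_mx j j) P v = ((j == ord0)%:R * (n%:R * P.@[fun=> 0])) *: v.
Proof.
have -> : delta_mx j j = sl_mx (traceless_part (delta_mx j j))
    + (\tr (delta_mx j j : 'M[K]_r.+1) / r.+1%:R) *: 1%:M.
  by rewrite scale_scalar_mx mulr1 /= subrK.
set c := _ / _; rewrite (linD (gl_act_linearl P v)) (linZ (gl_act_linearl P v)).
rewrite gl_act_sl gl_act_scalar rho_cartan /=; last first.
  apply/is_diag_mxP => k l kl.
  by rewrite [LHS]mxE [X in _ + X]mxE delta_offdiag // mxE (negPf (kl : k != l)) subr0.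
rewrite scalerA -scalerDl !mxE !eqxx mulrBl mulr1n andbb eq_sym.
by rewrite subrK.
Qed.

Lemma gl_act_nilp i j P : (i < j)%N -> gl_act (delta_mx i j) P v = 0.
Proof.
move=> ij; have t0 : \tr (delta_mx i j : 'M[K]_r.+1) = 0.
  by rewrite mxtrace_delta -val_eqE ltn_eqF.
rewrite /gl_act t0 !mul0r scale0r addr0 (weyl_nilp rhoW) // => k l lk /=.
rewrite t0 mul0r raddf0 subr0 mxE.
apply/eqP; rewrite pnatr_eq0 eqb0.
by apply: contraTN lk => /andP[/eqP-> /eqP->]; rewrite -ltnNge.
Qed.

(** Integrability leaves finitely many eigenvalues for an element of the Cartan
    subalgebra. *)
Lemma gl_act_finite_eigen h : exists evs : seq K,
  forall (c : K) u, in_cartan h -> gl_act h 1 u = c *: u -> u != 0 -> c \in evs.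
Proof.
have [D [uD dec indep]] := weyl_integrable rhoW.
exists [seq weight_val m h | m <- D] => c u hc; rewrite gl_act_sl => hu.
apply: contraNT => cD; have [w [hw uE]] := dec u.
have w0 m : m \in D -> (weight_val m h - c) *: w m = 0.
  apply: (indep (fun m => (weight_val m h - c) *: w m)) => [{}m mD h' h'c|].
    by rewrite (linZ (rho_linr _ _)) hw // !scalerA mulrC.
  transitivity (rho h 1 u - c *: u); last by rewrite hu subrr.
  rewrite uE (lin_sum (rho_linr _ _)) scaler_sumr -sumrB !big_seq.
  by apply: eq_bigr => {}m mD; rewrite hw // scalerBl.
rewrite uE big_seq big1 // => m mD; apply/eqP; have /eqP := w0 m mD.
rewrite scaler_eq0 subr_eq0 => /orP[/eqP mc|//].
by case/negP: cD; rewrite -mc; apply: map_f.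
Qed.

(** sl_2-theory for the root subalgebra of [E_ji], [E_ij] with [j < i]. *)
Lemma gl_act_lowering i j (m : nat) : (j < i)%N ->
  gl_act (delta_mx j j - delta_mx i i) 1 v = m%:R *: v ->
  iter m.+1 (gl_act (delta_mx i j) 1) v = 0.
Proof.
move=> ji hv; have ij : (i == j) = false by rewrite -val_eqE gtn_eqF.
have t0 : delta_mx j j - delta_mx i i \in @traceless K r.
  by rewrite unfold_in linearB /= !mxtrace_delta !eqxx subrr.
have hc : in_cartan (Sl t0).
  apply/is_diag_mxP => k l kl.
  by rewrite [LHS]mxE [X in _ + X]mxE !delta_offdiag // subrr.
have [evs hevs] := gl_act_finite_eigen (Sl t0).
apply: (@sl2_lowering K W (gl_act (delta_mx j i) 1) _
  (gl_act (delta_mx j j - delta_mx i i) 1) evs) => //.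
- exact: gl_act_linear.
- exact: gl_act_linear.
- by move=> u; rewrite gl_act_bracket !mul_delta_mx mulr1.
- move=> u; rewrite gl_act_bracket mulmxBl mulmxBr mulr1 !mul_delta_mx.
  rewrite !mul_delta_mx_0 ?ij ?[j == i]eq_sym ?ij // sub0r subr0 -opprD.
  by rewrite (linN (gl_act_linearl _ _)) (linD (gl_act_linearl _ _)) scaleNr scaler_nat.
- by move=> c u; apply: hevs.
- exact: gl_act_nilp.
Qed.

(** For [i <= j] this follows from the defining relations. For [i > j > 0] the
    vector [v] has weight zero for the root subalgebra, so [E_ij v = 0], and bracketing with
    [E_jj (x) P] introduces [P]. *)
Lemma gl_act_kill i j P : j != ord0 -> gl_act (delta_mx i j) P v = 0.
Proof.
move=> j0; have hd k Q : k != ord0 -> gl_act (delta_mx k k) Q v = 0.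
  by move=> /negPf k0; rewrite gl_act_diag k0 mul0r scale0r.
have [ij|ji|/val_inj ->] := ltngtP i j; [exact: gl_act_nilp| |exact: hd].
have i0 : i != ord0 by rewrite -val_eqE /= -lt0n (leq_ltn_trans _ ji).
have f0 : gl_act (delta_mx i j) 1 v = 0.
  have /= := @gl_act_lowering i j 0 ji; apply.
  by rewrite (linB (gl_act_linearl _ _)) !hd // subrr scale0r.
have := gl_act_bracket (delta_mx j j) (delta_mx i j) P 1 v.
rewrite f0 hd // !(lin0 (gl_act_linear _ _)) subrr mulr1 mul_delta_mx.
rewrite mul_delta_mx_0 -?val_eqE ?ltn_eqF // sub0r (linN (gl_act_linearl _ _)).
by move/eqP; rewrite eq_sym oppr_eq0 => /eqP.
Qed.

(** [(i, j, P)] stands for [E_ij (x) P]. *)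
Notation unit_elem := ('I_r.+1 * 'I_r.+1 * {mpoly K[d]})%type.
Notation slot := ('I_r.+1 * {mpoly K[d]})%type.
Implicit Types (X Y : unit_elem) (b : slot).

(** The associative product: [E_ij P] times [E_kl Q] is [E_il PQ] if [j = k],
    and zero, written as [E_il 0], otherwise. *)
Definition unit_mul X Y : unit_elem :=
  (X.1.1, Y.1.2, (X.1.2 == Y.1.1)%:R *: (X.2 * Y.2)).

(** [E_ij (x) P] acting on [W]. *)
Definition unit_act X : W -> W := gl_act (delta_mx X.1.1 X.1.2) X.2.

Lemma unit_mulA : associative unit_mul.
Proof.
move=> [[i j] P] [[k l] Q] [[p q] S]; rewrite /unit_mul /=; congr (_, _).
by rewrite -scalerAl -!scalerAr !scalerA mulrA mulrC.
Qed.

Lemma unit_act_mul X Y u :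
  unit_act (unit_mul X Y) u =
  gl_act (delta_mx X.1.1 X.1.2 *m delta_mx Y.1.1 Y.1.2) (X.2 * Y.2) u.
Proof.
rewrite /unit_act /unit_mul /= mul_delta_mx_cond -scaler_nat.
by rewrite (linZ (gl_act_linearm _ _)) (linZ (gl_act_linearl _ _)).
Qed.

Lemma unit_act_bracket X Y u :
  unit_act X (unit_act Y u) - unit_act Y (unit_act X u)
  = unit_act (unit_mul X Y) u - unit_act (unit_mul Y X) u.
Proof.
rewrite !unit_act_mul [Y.2 * _]mulrC -(linB (gl_act_linearl _ _)).
exact: gl_act_bracket.
Qed.

Lemma unit_act_linear X : linear (unit_act X).
Proof. exact: gl_act_linear. Qed.

Notation nop := (nop unit_mul unit_act).

(** These elements form a left ideal annihilating [v]; it has to contain the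
    elements [E_ij 0], which stand for zero. *)
Definition hw_killing X := X.1.2 != ord0 \/ X.2 = 0.

Lemma hw_killing_mul X Y : hw_killing Y -> hw_killing (unit_mul X Y).
Proof.
by case=> [j0|P0]; [left|right] => //=; rewrite P0 mulr0 scaler0.
Qed.

Lemma hw_killing_act X : hw_killing X -> unit_act X v = 0.
Proof.
case: X => [[i j] P] [|/= ->]; first exact: gl_act_kill.
exact: (lin0 (gl_act_linearm _ _)).
Qed.

Lemma nop_killing s X t : hw_killing X -> nop (s ++ X :: t) v = 0.
Proof.
move=> hX; exact: (nop_ideal unit_mulA unit_act_linear unit_act_bracket s t
  hw_killing_mul hw_killing_act hX).
Qed.

(** The slot [(i, P)], that is [e_i (x) P], seen in the first column of the
    matrix algebra as [E_i0 (x) P]. *)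
Definition slot_elem b : unit_elem := (b.1, ord0, b.2).

(** The image in [W] of the decomposable tensor with the given [n] slots, up to
    the factor [n!]. *)
Definition slot_nop (s : seq slot) : W := nop (map slot_elem s) v.

Lemma slotwise_elem i j P (s : seq slot) :
  slotwise (unit_mul (i, j, P)) (map slot_elem s)
  = map (map slot_elem) (slotwise (elem i j P) s).
Proof.
elim: s => //= b s ->; congr (_ :: _); rewrite -!map_comp.
by [].
Qed.

Lemma act_slot_nop i j P (s : seq slot) :
  gl_act (delta_mx i j) P (slot_nop s) =
  nop ((i, j, P) :: map slot_elem s) v
  + \sum_(t <- slotwise (elem i j P) s) slot_nop t.
Proof.
rewrite -[gl_act _ _]/(unit_act (i, j, P)) (L_nop unit_mul).
by rewrite slotwise_elem big_map.
Qed.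

Lemma slot_nop_front (s t : seq slot) b :
  slot_nop (s ++ b :: t) = slot_nop (b :: s ++ t).
Proof.
rewrite /slot_nop map_cat /= map_cat.
exact: (nop_front unit_mulA unit_act_linear unit_act_bracket).
Qed.

Lemma slot_nop_lowering i k : i != ord0 ->
  slot_nop (nseq k (i, 1)) = iter k (gl_act (delta_mx i ord0) 1) v.
Proof.
move=> i0; rewrite /slot_nop map_nseq; elim: k => //= k <-; rewrite nop_cons.
rewrite big_slotwise_nseq => [|s x t _]; last first.
  exact: (nop_front unit_mulA unit_act_linear unit_act_bracket).
rewrite (@nop_killing [::]) ?mul0rn ?subr0 //.
by right; rewrite /= eq_sym (negPf i0) scale0r.
Qed.

(** The key vanishing: there is no room for [n + 1] slots. The weight relation
    [E_i0 ^ (n + 1) v = 0] polarizes because [E_ki (x) P] with [i != 0] kills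
    [v] and sends the slot [(i, 1)] to [(k, P)]. *)
Lemma slot_nop_overflow (s : seq slot) : (0 < r)%N ->
  size s = n.+1 -> slot_nop s = 0.
Proof.
move=> r_gt0; pose one : 'I_r.+1 := lift ord0 (Ordinal r_gt0).
have one0 : one != ord0 by rewrite eq_sym neq_lift.
move: s; apply: (@polarization K W _ slot_nop (fun u => u = 0) n.+1 (one, 1)
  (fun b => elem b.1 one b.2) (fun b => gl_act (delta_mx b.1 one) b.2)) => //.
- by move=> a u w -> ->; rewrite scaler0 addr0.
- by move=> b u ->; apply: (lin0 (gl_act_linear _ _)).
- by move=> [i P]; rewrite /elem [_ == _]eqxx /= scale1r mulr1.
- by move=> s b t _; apply: slot_nop_front.
- by move=> [i P] s _; rewrite act_slot_nop (@nop_killing [::]) ?add0r //; left.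
rewrite slot_nop_lowering //; apply: gl_act_lowering => //.
rewrite (linB (gl_act_linearl _ _)) !gl_act_diag eqxx (negPf one0) meval1.
by rewrite mul0r scale0r subr0 mul1r mulr1.
Qed.

Lemma nop_overflow X (s : seq slot) : (0 < r)%N -> size s = n ->
  nop (X :: map slot_elem s) v = 0.
Proof.
move=> r_gt0 sn; case: X => [[i j] P]; have [->|j0] := eqVneq j ord0.
  by apply: (@slot_nop_overflow ((i, P) :: s)); rewrite //= sn.
by apply: (@nop_killing [::]); left.
Qed.

(** [E_00] is idempotent with eigenvalue [n] on [v], and the falling factorial
    [n (n - 1) .. 1] appears. *)
Lemma slot_nop_hw : slot_nop (nseq n (ord0, 1)) = (n`!)%:R *: v.
Proof.
rewrite /slot_nop map_nseq.
rewrite (@nop_idem _ _ _ _ _ unit_mulA unit_act_linear unit_act_bracket _ n%:R).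
- congr (_ *: _); rewrite -ffactnn ffact_prod natr_prod; apply: eq_bigr => i _.
  by rewrite natrB // ltnW.
- by rewrite /unit_mul /= scale1r mulr1.
- by rewrite /unit_act /= gl_act_diag eqxx meval1 mul1r mulr1.
Qed.

End WeylRelations.

(** * The universal map *)

Section MonomialExtension.
Variables (K : fieldType) (N : nat) (W : lmodType K) (g : 'X_{1..N} -> W).

(** The linear map with prescribed values on monomials. *)
Definition mono_ext (p : {mpoly K[N]}) : W := \sum_(m <- msupp p) p@_m *: g m.

Lemma mono_ext_bounded k p : (msize p <= k)%N ->
  mono_ext p = \sum_(m : 'X_{1..N < k}) p@_m *: g m.
Proof.
move=> pk; pose I : subFinType _ := 'X_{1..N < k}.
rewrite /mono_ext (big_mksub I) //=; first last.
- by move=> m /msize_mdeg_lt /leq_trans; apply.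
- exact: msupp_uniq.
by rewrite big_rmcond //= => i; move/memN_msupp_eq0 ->; rewrite scale0r.
Qed.

Lemma mono_ext_linear : linear mono_ext.
Proof.
move=> a p q; pose k := maxn (msize (a *: p + q)) (maxn (msize p) (msize q)).
rewrite !(@mono_ext_bounded k) ?leq_max ?leqnn ?orbT //.
rewrite scaler_sumr -big_split; apply: eq_bigr => m _ /=.
by rewrite mcoeffD mcoeffZ scalerDl scalerA.
Qed.

Lemma mono_extX m : mono_ext 'X_[m] = g m.
Proof. by rewrite /mono_ext msuppX big_seq1 mcoeffX eqxx scale1r. Qed.
End MonomialExtension.

Section UniversalMap.
Variables (K : numFieldType) (r n d : nat) (W : lmodType K).
Variables (rho : sl K r -> {mpoly K[d]} -> W -> W) (v : W).
Hypotheses (rhoW : weyl_conditions n rho v) (r_gt0 : (0 < r)%N).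
Implicit Types (P Q : {mpoly K[d]}) (h : sl K r) (x y : 'M[K]_r.+1) (u : W).
Implicit Types (i j : 'I_r.+1) (F G : tensor_poly K r n d) (w : word r n).

Notation slot_nop := (slot_nop n rho v).
Notation gl_act := (gl_act n rho).

(** The linear map sending the decomposable tensor with monomial slots [b] to
    [slot_nop b]. *)
Definition tensor_map F : W :=
  \sum_(w : word r n)
    mono_ext (fun m => slot_nop [seq (w k, 'X_[mpart k m]) | k <- enum 'I_n]) (F w).

Lemma tensor_map_linear : linear tensor_map.
Proof.
move=> a F G; rewrite /tensor_map scaler_sumr -big_split; apply: eq_bigr => w _.
by rewrite !ffunE mono_ext_linear.
Qed.

Lemma tensor_map_pure (c : 'I_n -> 'I_r.+1) (q : 'I_n -> 'X_{1..d}) :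
  tensor_map (pure (fun k => (c k, 'X_[q k]))) =
  slot_nop [seq (c k, 'X_[q k]) | k <- enum 'I_n].
Proof.
pose m : 'X_{1..#|{: 'I_n * 'I_d}|} :=
  [multinom q (enum_val t).1 (enum_val t).2 | t < #|{: 'I_n * 'I_d}|].
have mq k : mpart k m = q k by apply/mnmP => a; rewrite !mnmE enum_rankK.
rewrite /tensor_map (bigD1 [ffun k => c k]) //= big1 ?addr0 => [|w wc].
  have -> : pure (fun k => (c k, 'X_[q k] : {mpoly K[d]})) [ffun k => c k] = 'X_[m].
    rewrite ffunE mpolyX_parts; apply: eq_bigr => k _.
    by rewrite ffunE eqxx scale1r mq.
  rewrite mono_extX; congr slot_nop; apply: eq_map => k.
  by rewrite ffunE mq.
suff -> : pure (fun k => (c k, 'X_[q k] : {mpoly K[d]})) w = 0.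
  exact: (lin0 (mono_ext_linear _)).
have [k wk] : exists k, w k != c k.
  apply/existsP; rewrite -negb_forall; apply: contra wc => /forallP wc.
  by apply/eqP/ffunP => k; rewrite ffunE (eqP (wc k)).
by rewrite ffunE (bigD1 k) //= (negPf wk) scale0r mul0r.
Qed.

Lemma tensor_map_act x P F :
  tensor_map (poly_act x P F) = gl_act x P (tensor_map F).
Proof.
have lin := tensor_map_linear.
pose D x P F := tensor_map (poly_act x P F) - gl_act x P (tensor_map F).
have DF y Q : linear (D y Q).
  move=> a F1 F2; rewrite /D poly_act_linear !lin (gl_act_linear rhoW).
  by rewrite scalerBr opprD addrACA.
have DQ y F' : linear (fun Q => D y Q F').
  move=> a Q1 Q2; rewrite /D poly_act_linearm lin (gl_act_linearm rhoW).
  by rewrite scalerBr opprD addrACA.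
have Dy Q F' : linear (fun y => D y Q F').
  move=> a y1 y2; rewrite /D poly_act_linearl lin (gl_act_linearl rhoW).
  by rewrite scalerBr opprD addrACA.
(* Both sides are trilinear, so basis elements suffice. *)
apply/eqP; rewrite -subr_eq0 -/(D x P F); apply/eqP.
rewrite [F]tensor_poly_decomp (lin_sum (DF _ _)) big1 // => w _.
rewrite (lin_sum (DF _ _)) big1 // => m _; rewrite (linZ (DF _ _)).
rewrite [x]matrix_sum_delta (lin_sum (Dy _ _)) big1 ?scaler0 // => i _.
rewrite (lin_sum (Dy _ _)) big1 // => j _; rewrite (linZ (Dy _ _)).
rewrite [P]mpolyE (lin_sum (DQ _ _)) big1 ?scaler0 // => q _; rewrite (linZ (DQ _ _)).
apply/eqP; rewrite scaler_eq0 subr_eq0; apply/orP; right; apply/eqP.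
rewrite poly_act_pure tensor_map_pure act_slot_nop.
rewrite (nop_overflow rhoW _ r_gt0) ?add0r; last by rewrite size_map size_enum_ord.
rewrite slotwise_map ?enum_uniq // big_map big_enum /= (lin_sum lin).
apply: eq_bigr => k _; have [jw|jw] := eqVneq j (w k).
  pose c l := if l == k then i else w l.
  pose e l := if l == k then (q + mpart k m)%MM else mpart l m.
  have E l : (if l == k then elem i j 'X_[q] (w k, 'X_[mpart k m])
      else (w l, 'X_[mpart l m] : {mpoly K[d]})) = (c l, 'X_[e l]).
    rewrite /c /e; case: eqP => // _.
    by rewrite /elem /= jw eqxx scale1r mpolyXD.
  rewrite (eq_map E) -tensor_map_pure; congr tensor_map; congr pure.
  by apply/funext => l; rewrite E.
(* If [j] differs from [w k], both terms have a zero slot. *)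
rewrite (@pure0 _ _ _ _ _ k) ?(lin0 lin); last first.
  by rewrite eqxx /= (negPf jw) scale0r.
have [s1 [s2 ->]] : exists s1 s2, enum 'I_n = s1 ++ k :: s2.
  have : k \in enum 'I_n by rewrite mem_enum.
  by case/splitPr => s1 s2; exists s1, s2.
rewrite /slot_nop !map_cat /= (nop_killing rhoW) //; right.
by rewrite eqxx /= (negPf jw) scale0r.
Qed.

Notation poly_scale f G := ([ffun u : word r n => f * (G : tensor_poly K r n d) u]).

(** Power sums act on [tensor_map] through their value at the origin, and they
    generate the invariant polynomials: this is [invariant_tensor_gen] for the
    one-dimensional space [V_1]. *)
Lemma tensor_map_invariant (f : multipoly K n d) G : multi_invariant f ->
  tensor_map (poly_scale f G) = f.@[fun=> 0] *: tensor_map G.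
Proof.
move=> finv; pose w0 : word 0 n := [ffun=> ord0].
pose S (F : tensor_poly K 0 n d) := forall G,
  tensor_map (poly_scale (F w0) G) = (F w0).@[fun=> 0] *: tensor_map G.
suff /(_ G) : S [ffun=> f] by rewrite ffunE.
apply: invariant_tensor_gen => [G'|a F1 F2 S1 S2 G'|i P F SF G'|G'|s].
- rewrite ffunE meval0 scale0r -(lin0 tensor_map_linear); congr tensor_map.
  by apply/ffunP => u; rewrite !ffunE mul0r.
- rewrite !ffunE mevalD mevalZ scalerDl -scalerA -S1 -S2 -tensor_map_linear.
  by congr tensor_map; apply/ffunP => u; rewrite !ffunE mulrDl scalerAl.
- have -> : delta_mx i ord0 = 1%:M :> 'M[K]_1.
    by apply/matrixP => p q; rewrite !mxE !ord1.
  rewrite poly_act_scalar mevalM -scalerA -SF.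
  have -> : poly_scale ((\sum_(k < n) emb k P) * F w0) G'
      = poly_act 1%:M P (poly_scale (F w0) G').
    by apply/ffunP => u; rewrite poly_act_scalar !ffunE mulrA.
  rewrite tensor_map_act (gl_act_scalar rhoW); congr (_ *: _).
  rewrite raddf_sum /= (eq_bigr (fun=> P.@[fun=> 0])) => [|k _].
    by rewrite sumr_const card_ord mulr_natl.
  exact: meval0_emb.
- have -> : pure (fun=> (ord0, 1)) w0 = 1 :> multipoly K n d.
    by rewrite ffunE big1 // => k _; rewrite ffunE eqxx scale1r rmorph1.
  rewrite meval1 scale1r; congr tensor_map.
  by apply/ffunP => u; rewrite ffunE mul1r.
- by apply/ffunP => u; rewrite !ffunE finv.
Qed.

(** [tensor_map] only depends on the coefficients modulo the coinvariant
    ideal. *)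
Lemma tensor_map_coinv F G : coinv_tensor F = coinv_tensor G ->
  tensor_map F = tensor_map G.
Proof.
move=> FG; apply/eqP; rewrite -subr_eq0 -(linB tensor_map_linear).
have FGw w : F w - G w \in @coinv_ideal K n d.
  by apply/coinv_piP; move/ffunP/(_ w): FG; rewrite !ffunE.
pose at_w w p : tensor_poly K r n d := [ffun u => if u == w then p else 0].
have -> : F - G = \sum_w at_w w (F w - G w).
  apply/ffunP => w; rewrite sum_ffunE (bigD1 w) //= !ffunE eqxx big1 ?addr0 //.
  by move=> u /negPf uw; rewrite ffunE eq_sym uw.
rewrite (lin_sum tensor_map_linear) big1 // => w _.
have := FGw w; rewrite unfold_in => /asboolP[k [f [q [hf ->]]]].
have -> : at_w w (\sum_(i < k) f i * q i) = \sum_(i < k) poly_scale (f i) (at_w w (q i)).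
  apply/ffunP => u; rewrite sum_ffunE ffunE; case: eqP => [->|/eqP/negPf uw].
    by apply: eq_bigr => i _; rewrite !ffunE eqxx.
  by rewrite big1 // => i _; rewrite !ffunE uw mulr0.
rewrite (lin_sum tensor_map_linear) big1 // => i _.
have [finv f0] := hf i.
by rewrite tensor_map_invariant // f0 scale0r.
Qed.

(** The map induced by [tensor_map] on the invariants, normalized to send the
    generator to [v]. *)
Definition universal_map (F : invariants K r n d) : W :=
  (n`!)%:R^-1 *: tensor_map (lift_tensor F).

Lemma universal_map_linear : linear universal_map.
Proof.
move=> a F G; rewrite /universal_map scalerA mulrC -scalerA -scalerDr.
rewrite -tensor_map_linear; congr (_ *: _); apply: tensor_map_coinv.
by rewrite coinv_tensor_linear !lift_tensorK.
Qed.

Lemma universal_map_act h P (F : invariants K r n d) :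
  universal_map (inv_rho h P F) = rho h P (universal_map F).
Proof.
rewrite /universal_map -(gl_act_sl n rho) (linZ (gl_act_linear rhoW _ _)).
congr (_ *: _); rewrite -tensor_map_act; apply: tensor_map_coinv.
by rewrite lift_tensorK.
Qed.

Lemma universal_map_hw : universal_map (hw K r n d) = v.
Proof.
rewrite /universal_map (@tensor_map_coinv _ (pure (fun=> (ord0, 1)))); last first.
  by rewrite lift_tensorK.
have -> : pure (fun=> (ord0, 1)) = pure (fun=> (ord0, 'X_[0])) :> tensor_poly K r n d.
  by rewrite mpolyX0.
rewrite tensor_map_pure mpolyX0.
have -> : [seq (ord0, 1) | _ <- enum 'I_n] = nseq n (ord0, 1 : {mpoly K[d]}) :> seq ('I_r.+1 * _).
  by rewrite -[in nseq n _](size_enum_ord n); elim: (enum 'I_n) => //= _ s ->.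
rewrite (slot_nop_hw rhoW) scalerA mulVf ?scale1r //.
by rewrite pnatr_eq0 -lt0n fact_gt0.
Qed.

End UniversalMap.

(** * The local Weyl module *)

Section LocalWeyl.
Variables (K : numFieldType) (r n d : nat).
Hypothesis r_gt0 : (0 < r)%N.

Lemma invariants_local_weyl : local_weyl_module n (@inv_rho K r n d) (hw K r n d).
Proof.
split=> [|W rho v rhoW]; first exact: inv_rho_weyl.
pose lin := GRing.isLinear.Build K _ _ _ (@universal_map K r n d W rho v)
  (universal_map_linear rhoW r_gt0).
pose f : {linear invariants K r n d -> W} := HB.pack (@universal_map K r n d W rho v) lin.
have f_act x P F : f (inv_rho x P F) = rho x P (f F) by apply: universal_map_act.
have f_hw : f (hw K r n d) = v by apply: universal_map_hw.
exists f; split=> //.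
apply: (weyl_generated rhoW); first by exists (hw K r n d).
- by exists 0; rewrite linear0.
- by move=> a u w [F <-] [G <-]; exists (a *: F + G); rewrite linearP.
- by move=> x P w [F <-]; exists (inv_rho x P F).
Qed.

(** Local Weyl modules are unique: the universal maps between two of them are
    mutually inverse, since they exchange the generators. *)
Lemma local_weyl_unique (W W' : lmodType K)
    (rho : sl K r -> {mpoly K[d]} -> W -> W)
    (rho' : sl K r -> {mpoly K[d]} -> W' -> W') (v : W) (v' : W') :
  local_weyl_module n rho v -> local_weyl_module n rho' v' ->
  exists f : {linear W -> W'},
    bijective f /\ forall x P w, f (rho x P w) = rho' x P (f w).
Proof.
move=> [hv univ] [hv' univ'].
have [f [_ frho fv]] := univ _ _ _ hv'; have [g [_ grho gv]] := univ' _ _ _ hv.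
exists f; split=> //; exists g.
- apply: (weyl_generated hv); first by rewrite fv gv.
  + by rewrite !linear0.
  + by move=> a u w Hu Hw; rewrite !linearP Hu Hw.
  + by move=> x P w Hw; rewrite frho grho Hw.
- apply: (weyl_generated hv'); first by rewrite gv fv.
  + by rewrite !linear0.
  + by move=> a u w Hu Hw; rewrite !linearP Hu Hw.
  + by move=> x P w Hw; rewrite grho frho Hw.
Qed.

End LocalWeyl.

Theorem corollary2 (R : realType) (r n d : nat) (r_gt0 : (0 < r)%N)
    (d_gt0 : (0 < d)%N) :
  (exists (W : lmodType R[i]) (rho : sl R[i] r -> {mpoly R[i][d]} -> W -> W)
     (v : W), local_weyl_module n rho v) /\
  (forall (W : lmodType R[i]) (rho : sl R[i] r -> {mpoly R[i][d]} -> W -> W)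
     (v : W),
     local_weyl_module n rho v ->
     sl_isomorphic (fun x : sl R[i] r => rho x 1%R) (@inv_act R[i] r n d)).
Proof.
have M := @invariants_local_weyl R[i] r n d r_gt0.
split=> [|W rho v hv]; first by exists (invariants R[i] r n d), (@inv_rho _ r n d), (hw _ r n d).
have [f [fbij frho]] := local_weyl_unique hv M.
by exists f; split=> // x w; rewrite frho inv_rho1.
Qed.
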